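(* Let $m\ge 2$ be an integer, let $(E,\mathcal{E})$ be a measurable space, let $Q$ be a symmetric probability kernel on $(E^m,\mathcal{E}^{\otimes m})$, and let $\mu$ be a probability measure on $(E,\mathcal{E})$. For $t\ge 0$ let $\mu_t^{*,N}$ denote the law at time $t$ of a given agent $P$ in the system of $N$ interacting agents described in the context, and let $$\mu_t=\sum_{n\ge 0}p_{n}(t)\,\frac{1}{\#_m(n)}\sum_{A_n\in\mathbb{A}_n}\mu^{\circ_m A_n},$$ with $p_n(t)$, $\#_m(n)$, $\mathbb{A}_n$ and $\mu^{\circ_m A_n}$ as defined in the context. Then the sequence of laws $\mu_t^{*,N}$ converges to $\mu_t$ as $N$ increases.
   Context: Kernel. A symmetric probability kernel $Q$ on $(E^m,\mathcal{E}^{\otimes m})$ is a function $Q(x_1,\dots,x_m;C_1\times\cdots\times C_m)$ which is measurable in $(x_1,\dots,x_m)\in E^m$, is a probability measure on $E^m$ in its last argument, and satisfies $Q(x_1,\dots,x_m;C_1\times\cdots\times C_m)=Q(x_{\sigma(1)},\dots,x_{\sigma(m)};C_{\sigma(1)}\times\cdots\times C_{\sigma(m)})$ for every permutation $\sigma$ of $\{1,\dots,m\}$. The $N$-agent system. There are $N$ agents with states in $E$, initially i.i.d. with law $\mu$. Interactions occur at the jump times of a Poisson process with intensity $N/m$ (so each agent has meeting rate $1$). Each interaction involves a group of $m$ agents, each of the $\binom{N}{m}$ groups being chosen with equal probability $\binom{N}{m}^{-1}$, and the states of the $m$ agents involved change according to $Q$. The law of $P$ at time $t$ is determined by its random interaction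 history up to time $t$, i.e. the graph connecting all agents who have interacted directly or indirectly with $P$. Following this history backward from time $t$ and removing the meetings that would create a cycle (the mean number of which tends to $0$ as $N$ grows) gives a random $m$-ary tree which branches, when it has $n$ internal nodes, with the $N$-dependent intensity $\lambda_{N,n}=\frac{N}{m}\bigl((m-1)n+1\bigr)\binom{N-((m-1)n+1)}{m-1}\binom{N}{m}^{-1}$. Trees. An $m$-ary ordered tree is a rooted tree in which every node is either a leaf or an internal node with exactly $m$ children, in a fixed order. $\mathbb{A}_n$ denotes the set of $m$-ary ordered trees with $n$ internal nodes, taking into account the order of branching: $\mathbb{A}_0$ consists of the tree reduced to a single leaf, and an element of $\mathbb{A}_n$ is an element of $\mathbb{A}_{n-1}$ together with a choice of one of its leaves, which is replaced by an internal node with $m$ leaf children. Thus $|\mathbb{A}_n|=\#_m(n)=\prod_{k=1}^{n-1}((m-1)k+1)$ (empty product equal to $1$). Measure attached to a tree. For $A_n\in\mathbb{A}_n$, $\mu^{\circ_m A_n}$ is the law obtained at the root by placing $\mu$ on every leaf and proceeding towards the root: at an internal node whose $m$ ordered children carry laws $\mu_1,\dots,\mu_m$, the resulting law is $C\mapsto\int_{E^m}\mu_1(dx_1)\cdots\mu_m(dx_m)\,Q(x_1,\dots,x_m;C\times E^{m-1})$. In particular $\mu^{\circ_m A_0}=\mu$ for the single-leaf tree $A_0$. Weights. $(p_n(t))_{n\ge0}$ is the law at time $t$ of the pure birth process on $\{0,1,2,\dots\}$ started at $0$ with birth rate $(m-1)n+1$ in state $n$, i.e. the solution of $p_0'=-p_0$,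 $p_n'=((m-1)(n-1)+1)p_{n-1}-((m-1)n+1)p_n$ for $n\ge1$, with $p_0(0)=1$ and $p_n(0)=0$ for $n\ge 1$. *)

(* Defs.v *)
From HB Require Import structures.
From mathcomp Require Import all_boot all_order all_algebra all_fingroup.
From mathcomp Require Import zify.
From mathcomp Require Import all_classical all_reals all_analysis.

Set Implicit Arguments.
Unset Strict Implicit.
Unset Printing Implicit Defensive.

Import Order.TTheory GRing.Theory Num.Theory.
Import numFieldNormedType.Exports.

Local Open Scope classical_set_scope.
Local Open Scope ring_scope.

(* E^n is [n.-tuple E] with the library's product sigma-algebra. *)

Section cylinders.
Context d (T : measurableType d) (n : nat).

Definition rect (C : 'I_n -> set T) : set (n.-tuple T) :=
  [set y | forall i, C i (tnth y i)].

(* C * T^(n-1); the default value [point] is only reached when n = 0 *)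
Definition cyl_first (C : set T) : set (n.-tuple T) :=
  [set y | C (head point y)].

Lemma measurable_rect (C : 'I_n -> set T) :
  (forall i, measurable (C i)) -> measurable (rect C).
Proof.
move=> mC.
rewrite (_ : rect C = \big[setI/setT]_(i < n) ((@tnth n T)^~ i @^-1` C i)).
  apply: bigsetI_measurable => i _; rewrite -[X in measurable X]setTI.
  exact: measurable_tnth.
rewrite -bigcap_seq; apply/seteqP; split => y /= yC i.
  by move=> _; exact: yC.
by apply: yC; rewrite /= mem_index_enum.
Qed.

End cylinders.

Lemma measurable_cyl_first d (T : measurableType d) n (C : set T) :
  measurable C -> measurable (cyl_first (n := n) C).
Proof.
move=> mC; rewrite -[X in measurable X]setTI.
case: n => [|n]; last first.
  rewrite (_ : cyl_first C = (@tnth n.+1 T)^~ ord0 @^-1` C).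
    exact: measurable_tnth.
  by apply/seteqP; split=> y; rewrite /cyl_first /= (tnth_nth point) nth0.
have [Cp|Cp] := pselect (C point).
  rewrite (_ : cyl_first C = setT) ?setTI//.
  by apply/seteqP; split=> // y _; rewrite /cyl_first /= tuple0.
rewrite (_ : cyl_first C = set0) ?setI0//.
by apply/seteqP; split=> // y; rewrite /cyl_first /= tuple0.
Qed.

Section product_law.
Context d (T : measurableType d) (R : realType).

Definition tcons n (x : T * n.-tuple T) : n.+1.-tuple T :=
  [tuple of x.1 :: x.2].

Lemma measurable_tcons n : measurable_fun setT (@tcons n).
Proof. by apply: measurable_cons. Qed.

HB.instance Definition _ n := isMeasurableFun.Build _ _ _ _ (@tcons n)
  (@measurable_tcons n).

Fixpoint prod_law n : ('I_n -> probability T R) -> probability (n.-tuple T) R :=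
  match n with
  | 0 => fun=> dirac [tuple]
  | n'.+1 => fun nu =>
      distribution (nu ord0 \x prod_law (fun i => nu (lift ord0 i)))%E (@tcons n')
  end.

Lemma prod_law_rect n (nu : 'I_n -> probability T R) (C : 'I_n -> set T) :
  (forall i, measurable (C i)) ->
  prod_law nu (rect C) = (\prod_(i < n) nu i (C i))%E.
Proof.
elim: n nu C => [|n IHn] nu C mC.
  rewrite big_ord0 /= diracE mem_set //; by case.
rewrite big_ord_recl -IHn//= /distribution /pushforward.
rewrite (_ : _ @^-1` _ = C ord0 `*` rect (fun i => C (lift ord0 i))).
  by rewrite product_measure1E//; exact: measurable_rect.
apply/seteqP; split => -[x y] /=; rewrite /rect /tcons /=.
  move=> xyC; split=> [|i]; first exact: (xyC ord0).
  by have := xyC (lift ord0 i); rewrite tnthS.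
by move=> [xC yC] i; case: (unliftP ord0 i) => [j|] ->; rewrite ?tnthS.
Qed.

End product_law.

Definition symmetric_kernel d (E : measurableType d) (R : realType) (m : nat)
    (Q : R.-pker (m.-tuple E) ~> (m.-tuple E)) : Prop :=
  forall (s : 'S_m) (x : m.-tuple E) (C : 'I_m -> set E),
    (forall i, measurable (C i)) ->
    Q x (rect C) = Q [tuple tnth x (s i) | i < m] (rect (fun i => C (s i))).

Inductive mtree (m : nat) : Type :=
| Leaf
| Node of ('I_m -> mtree m).

Arguments Leaf {m}.

(* All trees obtained from A by replacing one leaf by an internal node with m
   leaf children, one entry per leaf of A. *)
Fixpoint branchings (m : nat) (A : mtree m) : seq (mtree m) :=
  match A with
  | Leaf => [:: Node (fun=> Leaf)]
  | Node f =>
      flatten [seq [seq Node (fun j => if j == i then B else f j)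
                   | B <- branchings (f i)]
              | i <- enum 'I_m]
  end.

(* The set A_n.  Its elements are orders of branching, so a shape is listed once
   for each order of branching that produces it (see [size_trees]). *)
Fixpoint trees (m n : nat) : seq (mtree m) :=
  if n is n'.+1 then flatten [seq branchings A | A <- trees m n']
  else [:: Leaf].

Definition num_trees (m n : nat) : nat :=
  (\prod_(1 <= k < n) ((m - 1) * k + 1))%N.

Lemma size_branchings_Node m (f : 'I_m -> mtree m) :
  size (branchings (Node f)) = (\sum_(i < m) size (branchings (f i)))%N.
Proof.
rewrite /= size_flatten /shape -map_comp sumnE big_map big_enum /=.
by apply: eq_bigr => i _; rewrite size_map.
Qed.

Lemma all_flatten (T : Type) (a : pred T) (ss : seq (seq T)) :
  all a (flatten ss) = all (all a) ss.
Proof. by elim: ss => //= s ss IH; rewrite all_cat IH. Qed.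

Lemma branchings_size m (A : mtree m) : (0 < m)%N ->
  all (fun B => size (branchings B) == size (branchings A) + (m - 1))%N
      (branchings A).
Proof.
move=> m_gt0; elim: A => [|f IH].
  apply/andP; split=> //; rewrite size_branchings_Node sum1_card card_ord.
  by rewrite [size _]/= subnKC.
rewrite size_branchings_Node/= all_flatten all_map; apply/allP => i _ /=.
rewrite all_map; apply: sub_all (IH i) => B /eqP sB /=.
rewrite size_branchings_Node [X in X == _](bigD1 i)//= eqxx sB.
rewrite [in eqbRHS](bigD1 i)//=; apply/eqP.
rewrite (eq_bigr (fun j => size (branchings (f j)))); first lia.
by move=> j /negbTE ->.
Qed.

Lemma size_trees m n : (0 < m)%N -> size (trees m n) = num_trees m n.
Proof.
move=> m_gt0.
have leaves k : all (fun A => size (branchings A) == (m - 1) * k + 1)%N (trees m k).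
  elim: k => [|k IH]; first by rewrite /= muln0.
  rewrite /= all_flatten all_map; apply: sub_all IH => A /eqP sA /=.
  by apply: sub_all (branchings_size A m_gt0) => B /eqP -> /=; rewrite sA; lia.
elim: n => [|n IH]; first by rewrite /num_trees big_geq.
have -> : size (trees m n.+1) = (size (trees m n) * ((m - 1) * n + 1))%N.
  rewrite /= size_flatten /shape -map_comp.
  elim: (trees m n) (leaves n) => [//|A s IHs] /= /andP[/eqP -> /IHs ->]; lia.
rewrite IH; case: n {IH} => [|n]; first by rewrite /num_trees !big_geq ?muln0.
by rewrite /num_trees [RHS]big_nat_recr.
Qed.

Section tree_law.
Context d (E : measurableType d) (R : realType) (m : nat).
Variable Q : R.-pker (m.-tuple E) ~> (m.-tuple E).

Section node_law.
Variable nu : 'I_m -> probability E R.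
Local Open Scope ereal_scope.

Definition node_law (C : set E) : \bar R :=
  \int[prod_law nu]_x Q x (cyl_first C).

Let node_law0 : node_law set0 = 0.
Proof.
rewrite /node_law integral0_eq// => x _.
by rewrite (_ : cyl_first set0 = set0)// measure0.
Qed.

Let node_law_ge0 C : 0 <= node_law C.
Proof. exact: integral_ge0. Qed.

Let node_law_sigma_additive : semi_sigma_additive node_law.
Proof.
move=> F mF tF mUF.
rewrite [X in _ --> X](_ : _ = \sum_(n <oo) node_law (F n)).
  by apply/cvg_closeP; split; [exact: is_cvg_nneseries|rewrite closeE].
rewrite -integral_nneseries//; last first.
  by move=> n; apply: measurable_kernel; exact: measurable_cyl_first.
apply: eq_integral => x _; apply/esym/cvg_lim => //=.
apply: (measure_sigma_additive (fun k => measurable_cyl_first (mF k))).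
apply/trivIsetP => i j _ _ ij; apply/seteqP; split=> // y [yi yj].
by have /trivIsetP/(_ i j I I ij)/seteqP[h _] := tF; exact: (h (head point y) (conj yi yj)).
Qed.

HB.instance Definition _ := isMeasure.Build _ _ _ node_law
  node_law0 node_law_ge0 node_law_sigma_additive.

Let node_law_setT : node_law setT = 1.
Proof.
rewrite /node_law (eq_integral (cst 1)); last first.
  by move=> x _; rewrite (_ : cyl_first setT = setT)// prob_kernel.
by rewrite integral_cst// mul1e; exact: probability_setT.
Qed.

HB.instance Definition _ := Measure_isProbability.Build _ _ _ node_law
  node_law_setT.

End node_law.

(* The law obtained at the root of A when every leaf carries mu. *)
Fixpoint tree_law (mu : probability E R) (A : mtree m) : probability E R :=
  match A with
  | Leaf => mu
  | Node f => node_law (fun i => tree_law mu (f i))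
  end.

(* mu_t, as a set function, for given weights p_n(t). *)
Definition limit_law (mu : probability E R) (p : nat -> R -> R) (t : R)
    (C : set E) : \bar R :=
  (\sum_(n <oo) (p n t / (num_trees m n)%:R)%:E *
     \sum_(A <- trees m n) tree_law mu A C)%E.

End tree_law.

(* (p_n) solves the forward equations of the pure birth process started at 0
   with rates (m-1)n+1.  At t = 0 only right-continuity is asked for. *)
Record birth_weights (R : realType) (m : nat) (p : nat -> R -> R) : Prop := {
  birth_continuous : forall n, {within `[0, +oo[, continuous (p n)};
  birth_init : forall n, p n 0 = (n == 0%N)%:R;
  birth_ode0 : forall t : R, 0 < t -> is_derive t 1 (p 0%N) (- p 0%N t);
  birth_odeS : forall n (t : R), 0 < t ->
    is_derive t 1 (p n.+1)
      (((m - 1) * n + 1)%N%:R * p n t - ((m - 1) * n.+1 + 1)%N%:R * p n.+1 t) }.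

(* K counts the points of a Poisson process with intensity lambda; [K t] is only
   constrained for t >= 0. *)
Record poisson_process (R : realType) d (Omega : measurableType d)
    (P : probability Omega R) (lambda : R) (K : R -> Omega -> nat) : Prop := {
  poisson_measurable : forall t a, 0 <= t -> measurable (K t @^-1` [set a]);
  poisson_init : forall w, K 0 w = 0%N;
  poisson_nondecreasing : forall s t w, 0 <= s -> s <= t -> (K s w <= K t w)%N;
  poisson_right_continuous : forall t w, 0 <= t ->
    \forall s \near t^'+, K s w = K t w;
  poisson_increments : forall n (t : nat -> R) (a : nat -> nat),
    0 <= t 0%N -> (forall j, (j < n)%N -> t j < t j.+1) ->
    P [set w | forall j, (j < n)%N -> K (t j.+1) w = (K (t j) w + a j)%N] =
    (\prod_(j < n) poisson_pmf (lambda * (t j.+1 - t j)) (a j))%:E }.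

Section agents.
Context d (E : measurableType d) (R : realType) (m N : nat).
Variable Q : R.-pker (m.-tuple E) ~> (m.-tuple E).
Variable mu : probability E R.

(* [g] lists the members of a group. *)
Definition group_states (g : m.-tuple 'I_N) (x : N.-tuple E) : m.-tuple E :=
  [tuple tnth x (tnth g i) | i < m].

(* The agents listed in g take the states y, the other ones keep theirs:
   [index j g = m] when j is not in g. *)
Definition update (g : m.-tuple 'I_N) (x : N.-tuple E) (y : m.-tuple E) :
    N.-tuple E :=
  [tuple nth (tnth x j) y (index j g) | j < N].

Section system.
Context d' (Omega : measurableType d').
Variable P : probability Omega R.
(* K t = number of interactions up to time t; G k = group involved in the
   (k+1)-st interaction; X k = states of the agents after k interactions. *)
Variables (K : R -> Omega -> nat) (G : nat -> Omega -> {set 'I_N}).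
Variable X : nat -> Omega -> N.-tuple E.

(* The events determined by the Poisson process, the initial states and the
   first k interactions. *)
Definition past (k : nat) : set (set Omega) :=
  <<s [set H | [\/ exists t a, 0 <= t /\ H = K t @^-1` [set a],
                   exists j B, [/\ (j <= k)%N, measurable B & H = X j @^-1` B] |
                   exists j S, (j < k)%N /\ H = G j @^-1` [set S]] ] >>.

Definition clock : set (set Omega) :=
  <<s [set H | exists t a, 0 <= t /\ H = K t @^-1` [set a]] >>.

(* The N-agent system.  Since Q is symmetric, the order in which the members of
   a group are listed is irrelevant in [system_step]. *)
Record agent_system : Prop := {
  system_clock : poisson_process P (N%:R / m%:R) K;
  system_group_measurable : forall k S, measurable (G k @^-1` [set S]);
  system_state_measurable : forall k, measurable_fun setT (X k);
  system_init : forall H B, clock H -> measurable B ->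
    P (H `&` X 0%N @^-1` B) = (P H * prod_law (fun=> mu) B)%E;
  system_step : forall k H (g : m.-tuple 'I_N) B,
    past k H -> uniq g -> measurable B ->
    P (H `&` G k @^-1` [set [set j in g]%SET] `&` X k.+1 @^-1` B) =
    (('C(N, m)%:R^-1)%:E *
     \int[P]_(w in H) Q (group_states g (X k w))
                        [set y | B (update g (X k w) y)])%E }.

Definition agent_state (i : 'I_N) (t : R) (w : Omega) : E :=
  tnth (X (K t w) w) i.

End system.

(* nu is the law at time t of an agent in some realization of the system. *)
Definition agent_law (t : R) (nu : probability E R) : Prop :=
  exists d' (Omega : measurableType d') (P : probability Omega R) K G X,
    @agent_system d' Omega P K G X /\
    exists i : 'I_N, forall C, measurable C ->
      nu C = P [set w | C (agent_state K X i t w)].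

End agents.

(* Total variation distance, normalized as a supremum over events.  As E carries
   no topology, it is the notion used for the convergence of laws on E. *)
Definition tv_dist d (E : measurableType d) (R : realType)
    (nu1 nu2 : set E -> \bar R) : \bar R :=
  ereal_sup [set `|nu1 C - nu2 C|%E | C in measurable].

(* Main.v *)
(** For each realization of the interaction history up to the [k]-th meeting,
    the states of a set of agents whose ancestries share no agent are independent
    with tree laws, because a meeting with a single tagged agent only requires the
    independence of the [m] states that enter it.  Discarding all histories in
    which a cycle appears bounds the law of an agent from below, for all events at
    once, by a mixture of tree laws; the weights are those of a discrete birth
    chain subordinated to the Poisson clock, and they are explicit finite sums of
    exponentials.  As [N] grows they converge to the weights [p_n(t) / #_m(n)],
    whose total mass is 1 since the limiting birth process does not explode.  A
    lower bound of full asymptotic mass, applied to an event and to its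
    complement, gives convergence in total variation, so that no estimate of the
    probability of a cycle is needed. *)
Require Import Defs.
From HB Require Import structures.
From mathcomp Require Import all_boot all_order all_algebra all_fingroup.
From mathcomp Require Import zify ring lra.
From mathcomp Require Import all_classical all_reals all_analysis.
From mathcomp Require Import measurable_realfun.

Set Implicit Arguments.
Unset Strict Implicit.
Unset Printing Implicit Defensive.

Import Order.TTheory GRing.Theory Num.Theory.
Import numFieldNormedType.Exports.

Local Open Scope classical_set_scope.
Local Open Scope ring_scope.

(** * Rectangles and product laws *)

Section rectangles.
Context d (T : measurableType d) (R : realType) (n : nat).
Local Open Scope ereal_scope.

Definition rectangles : set (set (n.-tuple T)) :=
  [set A | exists2 C, forall i, measurable (C i) & A = rect C].

Lemma rectangles_generate : measurable = <<s rectangles >>.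
Proof.
apply/seteqP; split => [|A].
  apply: smallest_sub; first exact: smallest_sigma_algebra.
  rewrite -bigcup_seq => A /= [i _ [B mB <-]].
  apply: sub_sigma_algebra.
  exists (fun j => if j == i then B else setT) => [j|].
    by case: ifP.
  rewrite setTI; apply/seteqP; split=> y /=.
    by move=> yB j; case: eqP => // ->.
  by move=> /(_ i); rewrite eqxx.
apply: smallest_sub; first exact: sigma_algebra_measurable.
by move=> B [C mC ->]; exact: measurable_rect.
Qed.

Lemma eq_measure_rectangles (m1 m2 : {measure set (n.-tuple T) -> \bar R}) :
  m1 setT < +oo ->
  (forall C, (forall i, measurable (C i)) -> m1 (rect C) = m2 (rect C)) ->
  forall A, measurable A -> m1 A = m2 A.
Proof.
move=> m1oo m12; have rectT : rect (fun=> setT) = [set: n.-tuple T].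
  by apply/seteqP; split.
apply: (measure_unique rectangles (fun=> setT)) => //.
- exact: rectangles_generate.
- move=> _ _ [C mC ->] [D mD ->]; exists (fun i => C i `&` D i).
    by move=> i; exact: measurableI.
  apply/seteqP; split=> y /=; first by move=> [yC yD] i; split; [exact: yC|exact: yD].
  by move=> yCD; split=> i; have [] := yCD i.
- by move=> k; exists (fun=> setT).
- by rewrite bigcup_const//; exists 0%N.
- by move=> _ [C mC ->]; exact: m12.
Qed.

(** Rectangles form a generating pi-system, so the product form on them fixes the law of [Y] on [H],
    and the integral follows by pushforward. Taking full rectangles shows that [c] is the mass of
    [H]; keeping it as a factor avoids conditioning on an event that may be null. *)
Lemma integral_prod_law d' (Omega : measurableType d') (P : probability Omega R)
    (H : set Omega) (Y : Omega -> n.-tuple T) (c : {nonneg R})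
    (nu : 'I_n -> probability T R) (f : n.-tuple T -> \bar R) :
  measurable H -> measurable_fun setT Y ->
  (forall C, (forall i, measurable (C i)) ->
     P (H `&` Y @^-1` rect C) = c%:num%:E * \prod_(i < n) nu i (C i)) ->
  measurable_fun [set: n.-tuple T] f -> (forall x, 0 <= f x) ->
  \int[P]_(w in H) f (Y w) = c%:num%:E * \int[prod_law nu]_x f x.
Proof.
move=> mH mY PHY mf f0.
have mfY : measurable_fun setT (f \o Y) by exact: measurableT_comp.
have -> : \int[P]_(w in H) f (Y w) = \int[mrestr P mH]_w f (Y w).
  rewrite (@ge0_negligible_integral _ _ _ _ setT (~` H))//=; last 2 first.
  - exact: measurableC.
  - by rewrite /mrestr setICl measure0.
  rewrite setDE setCK setTI; apply: eq_measure_integral => A mA AH.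
  by rewrite /= /mrestr setIidl.
pose phi := mfun_Sub (mem_set mY : Y \in mfun).
rewrite -[LHS](_ : \int[pushforward (mrestr P mH) phi]_y f y = _); last first.
  by rewrite ge0_integral_pushforward.
rewrite -ge0_integral_mscale//; apply: eq_measure_integral => A mA _.
apply: (eq_measure_rectangles) => //.
  rewrite /= /pushforward /mrestr preimage_setT setTI.
  by rewrite (le_lt_trans (probability_le1 P mH))// ltry.
move=> C mC; rewrite /= /pushforward /mrestr setIC PHY//.
by rewrite /mscale; congr (_ * _); rewrite -prod_law_rect.
Qed.

End rectangles.

(** * Laws of agents along acyclic histories *)

Section histories.
Context d (E : measurableType d) (R : realType) (m N : nat).
Variable Q : R.-pker (m.-tuple E) ~> (m.-tuple E).
Variable mu : probability E R.
Hypothesis m_gt0 : (0 < m)%N.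

(* [j] comes first since [cyl_first] reads the new state of the first member. *)
Definition listing (j : 'I_N) (s : {set 'I_N}) : m.-tuple 'I_N :=
  [tuple nth j (j :: enum (s :\ j)%SET) k | k < m].

Lemma listingE j (s : {set 'I_N}) : j \in s -> #|s| = m ->
  listing j s = j :: enum (s :\ j)%SET :> seq _.
Proof.
move=> js sm; have sz : size (j :: enum (s :\ j)%SET) = m.
  by rewrite /= -cardE -sm (cardsD1 j s) js.
apply: (@eq_from_nth _ j); first by rewrite size_tuple sz.
move=> k; rewrite size_tuple => km.
by rewrite -(tnth_nth j _ (Ordinal km)) tnth_mktuple.
Qed.

Lemma listing_uniq j (s : {set 'I_N}) : j \in s -> #|s| = m -> uniq (listing j s).
Proof.
move=> js sm; rewrite listingE //= enum_uniq andbT.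
by rewrite mem_enum !inE eqxx.
Qed.

Lemma mem_listing j (s : {set 'I_N}) i : j \in s -> #|s| = m -> (i \in listing j s) = (i \in s).
Proof.
move=> js sm; rewrite -[LHS]/(i \in tval _) listingE // inE mem_enum !inE.
by case: eqVneq => // ->.
Qed.

Definition node_prob (nu : 'I_m -> probability E R) : probability E R :=
  node_law Q nu.

(** The law that agent [j] would have if the states entering every meeting were independent;
    [prob_history] shows that it is the true one when no cycle appears. *)
Fixpoint hist_law (sigma : seq {set 'I_N}) (j : 'I_N) : probability E R :=
  match sigma with
  | [::] => mu
  | s :: sigma' => if j \in s
      then node_prob (fun k => hist_law sigma' (tnth (listing j s) k))
      else hist_law sigma' j
  end.

(* Histories list the latest group first; [acyclic sigma J] means that following
   the agents of [J] back through [sigma] creates no cycle. *)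
Fixpoint acyclic (sigma : seq {set 'I_N}) (J : {set 'I_N}) : bool :=
  match sigma with
  | [::] => true
  | s :: sigma' => (#|s| == m) &&
      match #|(s :&: J)%SET| with
      | 0 => acyclic sigma' J
      | 1 => acyclic sigma' (J :|: s)%SET
      | _ => false
      end
  end.

Lemma node_probE (nu : 'I_m -> probability E R) C :
  node_prob nu C = (\int[prod_law nu]_x Q x (cyl_first C))%E.
Proof. by []. Qed.

Context d' (Omega : measurableType d').
Variable P : probability Omega R.
Variables (K : R -> Omega -> nat) (G : nat -> Omega -> {set 'I_N}).
Variable X : nat -> Omega -> N.-tuple E.
Hypothesis XS : agent_system Q mu P K G X.

Fixpoint hist_event (sigma : seq {set 'I_N}) : set Omega :=
  match sigma with
  | [::] => setT
  | s :: sigma' => hist_event sigma' `&` G (size sigma') @^-1` [set s]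
  end.

Definition states_in (J : {set 'I_N}) (B : 'I_N -> set E) : set (N.-tuple E) :=
  [set x | forall j, j \in J -> B j (tnth x j)].

Lemma states_inE J B :
  states_in J B = rect (fun j => if j \in J then B j else setT).
Proof.
apply/seteqP; split=> x /= xB j; first by case: ifP => // /xB.
by move=> jJ; move: (xB j); rewrite jJ.
Qed.

Lemma measurable_states_in J B : (forall j, measurable (B j)) ->
  measurable (states_in J B).
Proof.
by move=> mB; rewrite states_inE; apply: measurable_rect => j; case: ifP.
Qed.

Lemma past_sub k : past K G X k `<=` measurable.
Proof.
apply: smallest_sub; first exact: sigma_algebra_measurable.
move=> H [[t [a [t0 ->]]]|[j [B [_ mB ->]]]|[j [S [_ ->]]]].
- exact: (poisson_measurable (system_clock XS)).
- by rewrite -[X in measurable X]setTI; exact: (system_state_measurable XS).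
- exact: (system_group_measurable XS).
Qed.

Lemma clock_past k H : clock K H -> past K G X k H.
Proof.
apply: smallest_sub; first exact: smallest_sigma_algebra.
by move=> A ?; apply: sub_sigma_algebra; exact: Or31.
Qed.

Lemma pastI k A B : past K G X k A -> past K G X k B -> past K G X k (A `&` B).
Proof.
exact: (@measurableI _ (g_sigma_algebraType _) A B).
Qed.

Lemma past_state k B : measurable B -> past K G X k (X k @^-1` B).
Proof.
by move=> mB; apply: sub_sigma_algebra; apply: Or32; exists k, B; split.
Qed.

Lemma past_hist sigma k : (size sigma <= k)%N -> past K G X k (hist_event sigma).
Proof.
elim: sigma => [_|s sigma IH /= sk].
  exact: (@measurableT _ (g_sigma_algebraType _)).
apply: pastI; first by apply: IH; exact: ltnW.
by apply: sub_sigma_algebra; apply: Or33; exists (size sigma), s; split.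
Qed.

Lemma hist_measurable sigma : measurable (hist_event sigma).
Proof. by apply: past_sub; exact: past_hist (leqnn _). Qed.

Lemma group_states_measurable (g : m.-tuple 'I_N) k :
  measurable_fun setT (fun w => group_states g (X k w)).
Proof.
apply/measurable_fun_tnthP => i.
rewrite (_ : _ \o _ = (@tnth N E)^~ (tnth g i) \o X k); last first.
  by apply/funext => w /=; rewrite tnth_mktuple.
apply: measurableT_comp; last exact: (system_state_measurable XS).
exact: measurable_tnth.
Qed.

Lemma tnth_update (g : m.-tuple 'I_N) x (y : m.-tuple E) j :
  tnth (update g x y) j = nth (tnth x j) y (index j g).
Proof. by rewrite tnth_mktuple. Qed.

Lemma step_group k H (s : {set 'I_N}) j B :
  past K G X k H -> j \in s -> #|s| = m -> measurable B ->
  P (H `&` G k @^-1` [set s] `&` X k.+1 @^-1` B) =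
    (('C(N, m)%:R^-1)%:E *
     \int[P]_(w in H) Q (group_states (listing j s) (X k w))
                        [set y | B (update (listing j s) (X k w) y)])%E.
Proof.
move=> pH js sm mB; rewrite -(system_step XS)// ?listing_uniq//.
congr (P (_ `&` _ @^-1` [set _] `&` _)).
by apply/setP => i; rewrite inE mem_listing.
Qed.

(** [update] leaves the agents outside [s] unchanged, so the integrand of [system_step] is the
    indicator of an event of the past, and the meeting costs only the probability of its group. *)
Lemma step_disjoint k H (s J : {set 'I_N}) B :
  past K G X k H -> #|s| = m -> #|(s :&: J)%SET| = 0%N ->
  (forall j, measurable (B j)) ->
  P (H `&` G k @^-1` [set s] `&` X k.+1 @^-1` states_in J B) =
    (('C(N, m)%:R^-1)%:E * P (H `&` X k @^-1` states_in J B))%E.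
Proof.
move=> pH sm sJ mB.
have [j js] : exists j, j \in s by apply/card_gt0P; rewrite sm.
have mX : measurable (X k @^-1` states_in J B).
  by apply: past_sub; apply: past_state; exact: measurable_states_in.
rewrite (step_group pH js sm (measurable_states_in J mB)); congr (_ * _)%E.
have upd x y : states_in J B (update (listing j s) x y) = states_in J B x.
  have upd_tnth i : i \in J -> tnth (update (listing j s) x y) i = tnth x i.
    move=> iJ; rewrite tnth_update nth_default // size_tuple -{1}(size_tuple (listing j s)).
    rewrite leqNgt index_mem mem_listing//.
    by apply/negP => iS; have := card0_eq sJ i; rewrite !inE iS iJ.
  apply/propext; split => xB i iJ; move: (xB i iJ); by rewrite upd_tnth.
under eq_integral do under eq_set do rewrite upd.
transitivity (\int[P]_(w in H) (\1_(X k @^-1` states_in J B) w)%:E)%E.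
  apply: eq_integral => w _; rewrite indicE.
  case: (pselect (states_in J B (X k w))) => xB.
    rewrite mem_set//= (_ : [set _ | _] = setT) ?prob_kernel//.
    by apply/seteqP; split.
  rewrite memNset//= (_ : [set _ | _] = set0) ?measure0//.
  by apply/seteqP; split.
rewrite integral_indic//; first by rewrite setIC.
exact: past_sub pH.
Qed.

(** Among the agents of [J] only [i] moves. Since [listing] puts [i] first, the kernel enters
    through its first marginal alone, while the other constraints bear on the past. *)
Lemma step_single k H (s J : {set 'I_N}) i B :
  past K G X k H -> #|s| = m -> (s :&: J = [set i])%SET ->
  (forall j, measurable (B j)) ->
  P (H `&` G k @^-1` [set s] `&` X k.+1 @^-1` states_in J B) =
    (('C(N, m)%:R^-1)%:E *
     \int[P]_(w in H `&` X k @^-1` states_in (J :\ i) B)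
        Q (group_states (listing i s) (X k w)) (cyl_first (B i)))%E.
Proof.
move=> pH sm sJ mB.
have /setIP[iS iJ] : (i \in s :&: J)%SET by rewrite sJ inE.
rewrite (step_group pH iS sm (measurable_states_in J mB)); congr (_ * _)%E.
rewrite integral_mkcondr; apply: eq_integral => w _; rewrite patchE.
have upd y : states_in J B (update (listing i s) (X k w) y) =
    (states_in (J :\ i) B (X k w) /\ cyl_first (B i) y).
  have updi : tnth (update (listing i s) (X k w) y) i = head point y.
    rewrite tnth_update -[tval (listing _ _)]/(_ : seq _) listingE//= eqxx.
    by rewrite -nth0; apply: set_nth_default; rewrite size_tuple.
  have updj j : j \in (J :\ i)%SET ->
      tnth (update (listing i s) (X k w) y) j = tnth (X k w) j.
    rewrite !inE => /andP[ji jJ].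
    rewrite tnth_update nth_default // size_tuple -{1}(size_tuple (listing i s)).
    rewrite leqNgt index_mem mem_listing//.
    apply: contra ji => jS; have : j \in (s :&: J)%SET by rewrite inE jS jJ.
    by rewrite sJ inE.
  apply/propext; split => [xB|[xB yB] j jJ].
    split; last by rewrite /cyl_first /= -updi; exact: xB.
    move=> j jJ; rewrite -(updj _ jJ); apply: xB.
    by move: jJ; rewrite !inE => /andP[].
  have [->|ji] := eqVneq j i; first by rewrite updi.
  have jJi : j \in (J :\ i)%SET by rewrite !inE ji jJ.
  by rewrite updj//; exact: xB.
under eq_set do rewrite upd.
case: (pselect (states_in (J :\ i) B (X k w))) => xB.
  by rewrite mem_set//; congr (Q _ _); apply/seteqP; split => y // [].
rewrite memNset// (_ : [set _ | _] = set0) ?measure0//.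
by apply/seteqP; split => y // [].
Qed.

(** Induction with [J] and [B] general, because a meeting with one tagged agent [i] turns [J] into
    [J :|: s]: by induction the members of [s] and the agents of [J :\ i] are independent before the
    meeting, and [integral_prod_law] evaluates the kernel. The clock event [H0] can be carried along
    since the initial states and the groups are independent of the clock. *)
Lemma prob_history H0 sigma (J : {set 'I_N}) B :
  clock K H0 -> acyclic sigma J -> (forall j, measurable (B j)) ->
  P (H0 `&` hist_event sigma `&` X (size sigma) @^-1` states_in J B) =
    (fine (P H0) * 'C(N, m)%:R^-1 ^+ size sigma *
     \prod_(j in J) fine (hist_law sigma j (B j)))%:E.
Proof.
move=> cH0; elim: sigma J B => [|s sigma IH] J B.
  move=> _ mB /=; rewrite setIT expr0 mulr1.
  rewrite (system_init XS)//; last exact: measurable_states_in.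
  rewrite states_inE prod_law_rect; last by move=> j; case: ifP.
  rewrite EFinM fineK; last first.
    apply: fin_num_measure; apply: (past_sub (k := 0)).
    exact: clock_past.
  congr (_ * _)%E; rewrite [in RHS]big_mkcond /= -prodEFin.
  rewrite (eq_bigr (fun j => (if j \in J then fine (mu (B j)) else 1)%:E)) //.
  move=> j _; case: ifP => _; last by rewrite probability_setT.
  by rewrite fineK// fin_num_measure.
move=> /= /andP[/eqP sm ac] mB; set k := size sigma.
have pH : past K G X k (H0 `&` hist_event sigma).
  by apply: pastI; [exact: clock_past|exact: past_hist].
rewrite setIA; case sJ : #|_| ac => [|[|//]] ac.
  rewrite (step_disjoint pH sm sJ mB) IH//.
  rewrite -EFinM; congr EFin.
  rewrite exprS [in RHS](eq_bigr (fun j => fine (hist_law sigma j (B j)))).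
    ring.
  move=> j jJ; rewrite ifF//.
  by apply/negP => js; have := card0_eq sJ j; rewrite !inE js jJ.
have /cards1P[i sJi] : #|(s :&: J)%SET| == 1%N by rewrite sJ.
have /setIP[iS iJ] : (i \in s :&: J)%SET by rewrite sJi inE.
rewrite (step_single pH sm sJi mB).
(* The probability of the past together with the constraints on the tagged agents other than [i]; it
   is the constant required by [integral_prod_law]. *)
set c : R := fine (P H0) * 'C(N, m)%:R^-1 ^+ k *
  \prod_(j in (J :\ i)%SET) fine (hist_law sigma j (B j)).
have c0 : 0 <= c.
  apply: mulr_ge0; last by apply: prodr_ge0 => j _; exact: fine_ge0.
  by apply: mulr_ge0; [exact: fine_ge0|rewrite exprn_ge0// invr_ge0 ler0n].
pose c' : {nonneg R} := NngNum c0.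
have gin n : tnth (listing i s) n \in s.
  by rewrite -(mem_listing _ iS sm) mem_tnth.
have block C : (forall n, measurable (C n)) ->
    P (H0 `&` hist_event sigma `&` X k @^-1` states_in (J :\ i) B `&`
      (fun w => group_states (listing i s) (X k w)) @^-1` rect C) =
    (c'%:num%:E * \prod_(n < m) hist_law sigma (tnth (listing i s) n) (C n))%E.
  (* [D] assigns to a member of the group the set [C] of its position, and to any other agent its
     set [B]. As [s] and [J :\ i] are disjoint, both families of constraints merge into one event to
     which the induction hypothesis applies. *)
  move=> mC; pose D j := if insub (index j (listing i s)) is Some n then C n else B j.
  have Dg n : D (tnth (listing i s) n) = C n.
    rewrite /D (tnth_nth i) index_uniq ?listing_uniq ?size_tuple// insubT//= => lt.
    by congr C; exact: val_inj.
  have DJ j : j \in (J :\ i)%SET -> j \notin s /\ D j = B j.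
    rewrite !inE => /andP[ji jJ].
    have js : j \notin s.
      apply: contra ji => jS; have : j \in (s :&: J)%SET by rewrite inE jS jJ.
      by rewrite sJi inE.
    split => //; rewrite /D insubN// -leqNgt -{1}(size_tuple (listing i s)).
    by rewrite leqNgt index_mem mem_listing.
  rewrite (_ : _ `&` _ = H0 `&` hist_event sigma `&`
      X k @^-1` states_in (J :|: s) D); last first.
    rewrite -setIA; congr (_ `&` _); apply/seteqP; split => w /=.
      move=> [xB xC] j; rewrite inE => jJs.
      have [js|js] := boolP (j \in s).
        move: (js); rewrite -(mem_listing j iS sm) => /tnthP[n ->].
        by rewrite Dg; have := xC n; rewrite tnth_mktuple.
      have jJi : j \in (J :\ i)%SET.
        rewrite !inE; move: jJs; rewrite (negbTE js) orbF => ->.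
        by rewrite andbT; apply: contraNneq js => ->.
      by rewrite (DJ _ jJi).2; exact: xB.
    move=> xD; split => [j jJ|n].
      by rewrite -(DJ _ jJ).2; apply: xD; move: jJ; rewrite !inE => /andP[_ ->].
    rewrite tnth_mktuple -Dg; apply: xD.
    by rewrite inE gin orbT.
  rewrite IH//; last first.
    by move=> j; rewrite /D; case: insub.
  rewrite /= /c -/k.
  have -> : (\prod_(j in (J :|: s)%SET) fine (hist_law sigma j (D j)) =
    \prod_(j in (J :\ i)%SET) fine (hist_law sigma j (B j)) *
    \prod_(n < m) fine (hist_law sigma (tnth (listing i s) n) (C n)))%R.
    rewrite (bigID (mem s)) /= mulrC; congr (_ * _)%R.
      apply: eq_big => j; last first.
        rewrite inE => /andP[jJs js].
        have jJi : j \in (J :\ i)%SET.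
          move: jJs; rewrite !inE (negbTE js) orbF => ->; rewrite andbT.
          by apply: contraNneq js => ->.
        by rewrite (DJ _ jJi).2.
      rewrite !inE; have [->|ji] /= := eqVneq j i; first by rewrite iS andbF.
      case: (boolP (j \in s)) => js; last by rewrite orbF andbT.
      rewrite andbF; apply/esym/negbTE/negP => jJ.
      have jJi : j \in (J :\ i)%SET by rewrite !inE ji jJ.
      by have [/negP] := DJ _ jJi.
    rewrite (eq_bigl (mem (tval (listing i s)))); last first.
      move=> j; rewrite !inE -[RHS]/(j \in listing i s) mem_listing//.
      by rewrite andb_idl// => ->; rewrite orbT.
    rewrite -big_uniq ?listing_uniq//= (big_tuple _ _ (listing i s)).
    by apply: eq_bigr => n _; rewrite Dg.
  rewrite !mulrA EFinM; congr (_ * _)%E; rewrite -prodEFin.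
  by apply: eq_bigr => n _; rewrite fineK// fin_num_measure.
rewrite (@integral_prod_law _ _ _ _ _ _ _ _ (group_states (listing i s) \o X k) c' _
  (fun x => Q x (cyl_first (B i))) _ _ block)//; first last.
- apply: measurable_kernel; exact: measurable_cyl_first.
- exact: group_states_measurable.
- apply: measurableI; first exact: past_sub pH.
  by apply: (past_sub (k := k)); apply: past_state; exact: measurable_states_in.
rewrite (big_setD1 i iJ) /= iS -node_probE.
rewrite -[in LHS](@fineK _ (node_prob _ _)); last by rewrite fin_num_measure.
rewrite -!EFinM; congr EFin; rewrite /c exprS.
rewrite [X in _ = _ * (_ * X)](eq_bigr (fun j => fine (hist_law sigma j (B j)))).
  ring.
move=> j; rewrite !inE => /andP[ji jJ]; rewrite ifF//.
apply/negP => jS; have : j \in (s :&: J)%SET by rewrite inE jS jJ.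
by rewrite sJi inE (negbTE ji).
Qed.

End histories.

(** * Trees with labelled leaves and grafting *)

Section labelled_trees.
Context (m : nat) (L : eqType).

(** Ancestral trees: a label names the agent sitting at a leaf, so that a meeting acts at a definite
    leaf. Distinct labels express the absence of cycles, and [lshape] returns to the trees of the
    statement. *)
Inductive ltree : Type :=
| LLeaf of L
| LNode of ('I_m -> ltree).

Fixpoint labels (A : ltree) : seq L :=
  match A with
  | LLeaf l => [:: l]
  | LNode f => flatten [seq labels (f i) | i <- enum 'I_m]
  end.

Fixpoint lshape (A : ltree) : mtree m :=
  match A with
  | LLeaf _ => Leaf
  | LNode f => Node (fun i => lshape (f i))
  end.

Fixpoint graft (l : L) (T A : ltree) : ltree :=
  match A with
  | LLeaf l' => if l' == l then T else A
  | LNode f => LNode (fun i => graft l T (f i))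
  end.

Definition corolla (g : 'I_m -> L) : ltree := LNode (fun i => LLeaf (g i)).

Lemma mem_labels_LNode f l i : l \in labels (f i) -> l \in labels (LNode f).
Proof.
move=> lfi; apply/flattenP; exists (labels (f i)) => //.
by apply/mapP; exists i; rewrite ?mem_enum.
Qed.

Lemma labels_LNode_uniq f l i j : uniq (labels (LNode f)) ->
  l \in labels (f i) -> l \in labels (f j) -> i = j.
Proof.
rewrite /=; have : i \in enum 'I_m by rewrite mem_enum.
have : j \in enum 'I_m by rewrite mem_enum.
elim: (enum 'I_m) (enum_uniq 'I_m) => // k s IH /= /andP[ks us].
rewrite !inE cat_uniq => js is_ /and3P[_ /hasPn dis uf] li lj.
have in_rest k' : k' \in s -> l \in labels (f k') -> l \in labels (f k) -> False.
  move=> k's lk' lk; have := dis l; rewrite lk => /(_ _)/negP; apply => //.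
  by apply/flattenP; exists (labels (f k')) => //; apply/mapP; exists k'.
case/orP: js => [/eqP jk|js]; case/orP: is_ => [/eqP ik|is_].
- by rewrite jk ik.
- by subst j; case: (in_rest i).
- by subst i; case: (in_rest j).
- exact: IH.
Qed.

Lemma uniq_labels_child f i : uniq (labels (LNode f)) -> uniq (labels (f i)).
Proof.
rewrite /=; have : i \in enum 'I_m by rewrite mem_enum.
elim: (enum 'I_m) => // k s IH /=; rewrite inE cat_uniq => /orP[/eqP -> /and3P[]//|].
by move=> /IH h /and3P[_ _ /h].
Qed.

Lemma graft_notin l T A : l \notin labels A -> graft l T A = A.
Proof.
elim: A => [l'|f IH] /=; first by rewrite inE eq_sym => /negbTE ->.
move=> lf; congr LNode; apply/funext => i; apply: IH.
by apply: contra lf => /mem_labels_LNode.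
Qed.

Lemma lshape_graft l T T' A : lshape T = lshape T' ->
  lshape (graft l T A) = lshape (graft l T' A).
Proof.
move=> TT'; elim: A => [l'|f IH] /=; first by case: ifP.
by congr Node; apply/funext => i.
Qed.

(** With distinct labels, grafting at [l] replaces exactly one leaf, and [labels] lists the leaves
    in the order used by [branchings]. The new labels [g l] are arbitrary because only the shape is
    kept. *)
Lemma branchings_lshape (g : L -> 'I_m -> L) A : uniq (labels A) ->
  [seq lshape (graft l (corolla (g l)) A) | l <- labels A] = branchings (lshape A).
Proof.
elim: A => [l|f IH] uf /=; first by rewrite eqxx.
rewrite map_flatten -map_comp; congr flatten; apply: eq_map => i /=.
rewrite -IH; last exact: uniq_labels_child uf.
rewrite -map_comp; apply/eq_in_map => l li /=; congr Node; apply/funext => j.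
case: eqVneq => [->//|ji]; rewrite graft_notin//.
by apply: contra ji => lj; apply/eqP; exact: labels_LNode_uniq uf lj li.
Qed.

(** Counting with multiplicity gives a recursion free of any distinctness hypothesis; distinctness
    after a graft is then read off the counts. *)
Lemma count_labels_graft l T A x :
  count_mem x (labels (graft l T A)) =
  ((x != l) * count_mem x (labels A) + count_mem l (labels A) * count_mem x (labels T))%N.
Proof.
elim: A => [l'|f IH] /=.
  rewrite !addn0; case: (eqVneq l' l) => [->|l'l] /=.
    by rewrite mul1n eq_sym; case: (l == x).
  by rewrite mul0n !addn0; case: (eqVneq l' x) => [<-|]; rewrite ?l'l ?muln0.
rewrite !count_flatten -!map_comp !sumnE !big_map big_distrr big_distrl /= -big_split /=.
by apply: eq_bigr => i _; exact: IH.
Qed.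

Lemma labels_corolla (g : m.-tuple L) : labels (corolla (tnth g)) = g.
Proof.
rewrite /= -[RHS](map_tnth_enum g).
by elim: (enum 'I_m) => //= i s ->.
Qed.

Section graft_corolla.
Variables (l : L) (g : m.-tuple L) (A : ltree).
Hypotheses (uA : uniq (labels A)) (ug : uniq g).
Hypothesis gA : forall x, (x \in labels A) && (x \in g) = (x == l).
Let B := graft l (corolla (tnth g)) A.

Let count_B x : count_mem x (labels B) = ((x \in labels A) || (x \in g)).
Proof.
have := gA l; rewrite eqxx => /andP[lA lg].
rewrite count_labels_graft labels_corolla !count_uniq_mem// lA mul1n.
have := gA x; case: (eqVneq x l) => [->|_]; first by rewrite lA lg.
by rewrite mul1n; case: (x \in labels A); case: (x \in g).
Qed.

Lemma mem_labels_graft x : (x \in labels B) = (x \in labels A) || (x \in g).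
Proof. by rewrite -has_pred1 has_count count_B; case: (_ || _). Qed.

Lemma uniq_labels_graft : uniq (labels B).
Proof. by apply: count_mem_uniq => x; rewrite count_B mem_labels_graft. Qed.

End graft_corolla.

End labelled_trees.

(** * Laws at the root of a labelled tree *)

Section ltree_law.
Context d (E : measurableType d) (R : realType) (m : nat) (L : eqType).
Variable Q : R.-pker (m.-tuple E) ~> (m.-tuple E).

Fixpoint ltree_law (nu : L -> probability E R) (A : ltree m L) : probability E R :=
  match A with
  | LLeaf l => nu l
  | LNode f => node_prob Q (fun i => ltree_law nu (f i))
  end.

Lemma eq_ltree_law nu nu' A : {in labels A, nu =1 nu'} ->
  ltree_law nu A = ltree_law nu' A.
Proof.
elim: A => [l|f IH] /= eqnu; first by apply: eqnu; rewrite inE.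
congr node_prob; apply/funext => i; apply: IH => l lfi; apply: eqnu.
exact: mem_labels_LNode lfi.
Qed.

Lemma ltree_law_graft nu l T A : ltree_law nu (graft l T A) =
  ltree_law (fun l' => if l' == l then ltree_law nu T else nu l') A.
Proof.
elim: A => [l'|f IH] /=; first by case: ifP.
by congr node_prob; apply/funext => i.
Qed.

Lemma ltree_law_cst mu A : ltree_law (fun=> mu) A = tree_law Q mu (lshape A).
Proof.
elim: A => [//|f IH] /=; rewrite /node_prob.
by under eq_fun do rewrite IH.
Qed.

End ltree_law.

(** * Path weights of a discrete birth chain *)

Section chain.
Variable R : realType.

(* [chain a r k i n]: weight of the [k]-step paths from [i] to [i + n] of the
   chain staying at [j] with weight [a j] and moving to [j + 1] with weight [r j]. *)
Fixpoint chain (a r : nat -> R) (k i n : nat) : R :=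
  if k is k'.+1 then
    a i * chain a r k' i n +
    (if n is n'.+1 then r i * chain a r k' i.+1 n' else 0)
  else (n == 0%N)%:R.

End chain.

Lemma size_labels_graft m (L : eqType) l (T A : ltree m L) :
  (size (labels (graft l T A)) + count_mem l (labels A) =
   size (labels A) + count_mem l (labels A) * size (labels T))%N.
Proof.
elim: A => [l'|f IH] /=; first by case: eqVneq => _ /=; lia.
rewrite !size_flatten !count_flatten /shape -!map_comp !sumnE !big_map.
rewrite big_distrl /= -!big_split /=.
by apply: eq_bigr => i _; exact: IH.
Qed.

(** * Counting the groups by their intersection with a set of agents *)

Section group_counting.
Variables (N m : nat) (J : {set 'I_N}).

Let card_outside : (N - #|J| = #|(~: J)%SET|)%N.
Proof. by have := cardsC J; rewrite card_ord; lia. Qed.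

Lemma card_disjoint_groups :
  #|[set s : {set 'I_N} | (#|s| == m) && (#|(s :&: J)%SET| == 0)%N]%SET| =
  'C(N - #|J|, m).
Proof.
rewrite card_outside -cards_draws.
apply: eq_card => s; rewrite !inE andbC; congr (_ && _).
rewrite cards_eq0; apply/eqP/fintype.subsetP => [sJ i iS|sJ].
  rewrite !inE; apply/negP => iJ; have : i \in (s :&: J)%SET by rewrite inE iS iJ.
  by rewrite sJ inE.
apply/setP => i; rewrite !inE; apply/negP => /andP[/sJ]; rewrite !inE.
by move=> /negbTE ->.
Qed.

(** Removing [l] is a bijection onto the sets of [m - 1] agents outside [J]. *)
Lemma card_single_groups l : (0 < m)%N -> l \in J ->
  #|[set s : {set 'I_N} | (#|s| == m) && (s :&: J == [set l])%SET]%SET| =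
  'C(N - #|J|, m - 1).
Proof.
move=> m0 lJ.
rewrite card_outside -cards_draws.
pose D := [set s : {set 'I_N} | (s \subset ~: J) && (#|s| == m - 1)%N]%SET.
have lD s : s \in D -> l \notin s.
  rewrite inE => /andP[/fintype.subsetP sJ _]; apply/negP => /sJ.
  by rewrite !inE lJ.
transitivity #|[set (l |: s)%SET | s in D]%SET|; last first.
  apply: card_in_imset => s s' /lD ls /lD ls' e.
  by rewrite -(finset.setU1K ls) e finset.setU1K.
apply: eq_card => s; rewrite !inE; apply/andP/imsetP.
  move=> [/eqP sm /eqP sJ].
  have /setIP[ls _] : l \in (s :&: J)%SET by rewrite sJ inE.
  exists (s :\ l)%SET; last by rewrite finset.setD1K.
  rewrite -[_ \in _]/(_ \in D) inE; apply/andP; split.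
    apply/fintype.subsetP => i; rewrite !inE => /andP[il iS].
    apply: contra il => iJ; have : i \in (s :&: J)%SET by rewrite inE iS iJ.
    by rewrite sJ inE.
  by move: sm; rewrite (cardsD1 l s) ls => <-; rewrite addKn.
move=> [s' s'D ->]; have ls' := lD _ s'D.
move: s'D; rewrite -[_ \in _]/(_ \in D) inE => /andP[/fintype.subsetP sJ /eqP s'm].
split; first by rewrite cardsU1 ls' s'm; apply/eqP; lia.
apply/eqP/setP => i; rewrite !inE; case: eqVneq => [->|il] /=; first by rewrite lJ.
by apply/negP => /andP[/sJ]; rewrite !inE => /negbTE ->.
Qed.

End group_counting.

(** * Summation over acyclic histories *)

Section history_sum.
Context d (E : measurableType d) (R : realType) (m N : nat).
Variable Q : R.-pker (m.-tuple E) ~> (m.-tuple E).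
Variable mu : probability E R.
Hypothesis m_gt0 : (0 < m)%N.
Variable C : set E.

Fixpoint histories (k : nat) : seq (seq {set 'I_N}) :=
  if k is k'.+1 then
    [seq s :: sigma | s <- enum {: {set 'I_N}}, sigma <- histories k']
  else [:: [::]].

Let c : R := 'C(N, m)%:R^-1.

Definition label_set (A : ltree m 'I_N) : {set 'I_N} := [set l in labels A]%SET.

(** With [A] the ancestral tree built from the later meetings, this is the contribution to the law
    of its root of the acyclic histories formed by the [k] earlier meetings. *)
Definition history_sum k (A : ltree m 'I_N) : R :=
  \sum_(sigma <- histories k | acyclic m sigma (label_set A))
    c ^+ k * fine (ltree_law Q (hist_law Q mu sigma) A C).

Let first_group k A s : R :=
  \sum_(sigma <- histories k | acyclic m (s :: sigma) (label_set A))
    c ^+ k.+1 * fine (ltree_law Q (hist_law Q mu (s :: sigma)) A C).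

Let c_ge0 : 0 <= c. Proof. by rewrite invr_ge0 ler0n. Qed.

Let history_sumS k A : history_sum k.+1 A = \sum_s first_group k A s.
Proof.
rewrite /history_sum big_mkcond /= big_allpairs_dep /= big_enum /=.
by apply: eq_bigr => s _; rewrite /first_group -big_mkcond.
Qed.

Let history_sum_ge0 k A : 0 <= history_sum k A.
Proof. by apply: sumr_ge0 => s _; rewrite mulr_ge0 ?exprn_ge0// fine_ge0. Qed.

Let first_group_ge0 k A s : 0 <= first_group k A s.
Proof.
apply: sumr_ge0 => sigma _; rewrite mulr_ge0 ?exprn_ge0 ?fine_ge0//.
Qed.

Let first_group_disjoint k A (s : {set 'I_N}) :
  #|s| = m -> #|(s :&: label_set A)%SET| = 0%N ->
  first_group k A s = c * history_sum k A.
Proof.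
move=> sm sA; rewrite /first_group /history_sum mulr_sumr.
apply: eq_big => [sigma|sigma _] /=; first by rewrite sm eqxx sA.
rewrite exprS mulrA (@eq_ltree_law _ _ _ _ _ _ _ (hist_law Q mu sigma))//.
move=> l lA /=; rewrite ifF//; apply/negP => ls.
by have := card0_eq sA l; rewrite !inE ls lA.
Qed.

(** Going back through the meeting replaces the leaf [l] by a corolla labelled by the group, and the
    label set becomes the union prescribed by [acyclic]. *)
Let first_group_single k A (s : {set 'I_N}) l :
  #|s| = m -> (s :&: label_set A = [set l])%SET -> uniq (labels A) ->
  first_group k A s = c * history_sum k (graft l (corolla (tnth (listing m l s))) A).
Proof.
move=> sm sA uA; rewrite /first_group /history_sum mulr_sumr.
have /setIP[ls] : l \in (s :&: label_set A)%SET by rewrite sA inE.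
rewrite inE => lA.
have sAP x : (x \in labels A) && (x \in listing m l s) = (x == l).
  by rewrite mem_listing// andbC; have /setP/(_ x) := sA; rewrite !inE.
apply: eq_big => [sigma|sigma _] /=.
  rewrite sm eqxx sA cards1 /=; congr acyclic; apply/setP => x.
  by rewrite !inE mem_labels_graft ?mem_listing ?listing_uniq.
rewrite exprS mulrA ltree_law_graft.
congr (_ * fine (Probability.sort _ _)); apply: eq_ltree_law => x xA /=.
case: eqVneq => [->|xl]; first by rewrite ls.
rewrite ifF//; apply/negP => xs; have := sAP x.
by rewrite xA mem_listing// xs (negbTE xl).
Qed.

(** The recursion is on the first branching, in step with the ancestral tree growing backward in
    time, whereas [trees] recurses on the last one. *)
Fixpoint branch_sum n (A : mtree m) : R :=
  if n is n'.+1 then \sum_(B <- branchings A) branch_sum n' B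
  else fine (tree_law Q mu A C).

Lemma branch_sum_ge0 n A : 0 <= branch_sum n A.
Proof.
elim: n A => [|n IH] A /=; first exact: fine_ge0.
by apply: sumr_ge0 => B _.
Qed.

Lemma branch_sum_trees n : branch_sum n Leaf =
  \sum_(A <- trees m n) fine (tree_law Q mu A C).
Proof.
(* Interpolation between the two recursions: [trees] performs the first [n] branchings and
   [branch_sum] the remaining [k]. *)
suff h k : \sum_(A <- trees m n) branch_sum k A = branch_sum (n + k) Leaf.
  by rewrite (h 0) addn0.
elim: n k => [|n IH] k; first by rewrite /= big_seq1.
by rewrite addSnnS -IH /= big_flatten /= big_map.
Qed.

(** Probability that a uniform group avoids all leaves of a tree with [i] internal nodes; for
    [branch_weight], that it meets them in one prescribed leaf. The choice of that leaf is summed in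
    [branch_sum]. *)
Definition stay_weight i : R := 'C(N - ((m - 1) * i + 1), m)%:R * c.
Definition branch_weight i : R := 'C(N - ((m - 1) * i + 1), m - 1)%:R * c.

(** The latest group either avoids the leaves of [A], or meets one leaf and grafts a corolla there;
    the other groups are cyclic and contribute nothing. The weights depend on [A] only through its
    number of leaves, so the sum over labelled trees reduces to shapes. Cutting at [M] discards
    nonnegative terms. *)
Lemma history_sum_ge k A i M : uniq (labels A) ->
  size (labels A) = ((m - 1) * i + 1)%N ->
  \sum_(n < M) chain stay_weight branch_weight k i n * branch_sum n (lshape A)
  <= history_sum k A.
Proof.
elim: k A i M => [|k IH] A i M uA sA.
  rewrite /history_sum [leRHS]big_cons /= big_nil addr0 expr0 mul1r ltree_law_cst.
  case: M => [|M]; first by rewrite big_ord0 fine_ge0.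
  rewrite big_ord_recl /= mul1r big1 ?addr0//.
  by move=> n _; rewrite mul0r.
case: M => [|M]; first by rewrite big_ord0.
pose J := label_set A.
have cardJ : #|J| = ((m - 1) * i + 1)%N.
  by rewrite -sA cardsE; apply/card_uniqP.
(* Dummy labels for the grafted corolla, whose shape alone matters here. *)
pose g0 (l : 'I_N) (_ : 'I_m) := l.
have bs n : branch_sum n.+1 (lshape A) =
    \sum_(l in J) branch_sum n (lshape (graft l (corolla (g0 l)) A)).
  rewrite /= -(branchings_lshape g0 uA) big_map big_uniq//=.
  by apply: eq_bigl => l; rewrite inE.
set w := chain _ _.
have -> : \sum_(n < M.+1) w k.+1 i n * branch_sum n (lshape A) =
    stay_weight i * (\sum_(n < M.+1) w k i n * branch_sum n (lshape A)) +
    branch_weight i * (\sum_(l in J) \sum_(n < M)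
      w k i.+1 n * branch_sum n (lshape (graft l (corolla (g0 l)) A))).
  rewrite exchange_big /=; under [X in _ + _ * X]eq_bigr do rewrite -mulr_sumr -bs.
  rewrite !mulr_sumr [X in _ = _ + X](_ : _ = \sum_(n < M.+1)
    if nat_of_ord n is n'.+1 then
      branch_weight i * (w k i.+1 n' * branch_sum n'.+1 (lshape A)) else 0).
    rewrite -big_split /=; apply: eq_bigr => -[[|n] nM] _; rewrite /w /=.
      by rewrite !addr0 mulrA.
    by rewrite mulrDl !mulrA.
  by rewrite big_ord_recl /= add0r.
rewrite history_sumS.
(* At most one term on the left is nonzero: the group avoids [J], or meets it in exactly one
   agent. *)
have le_first (s : {set 'I_N}) : (if (#|s| == m) && (#|(s :&: J)%SET| == 0)%N then
    c * history_sum k A else 0) +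
    \sum_(l in J) (if (#|s| == m) && (s :&: J == [set l])%SET
      then first_group k A s else 0) <= first_group k A s.
  have [sm|_] /= := eqVneq #|s| m; last by rewrite big1 ?addr0.
  have [sJ|sJ] := eqVneq #|(s :&: J)%SET| 0%N.
    rewrite big1 ?addr0 ?first_group_disjoint// => l _.
    by case: eqVneq => // e; move: sJ; rewrite e cards1.
  rewrite add0r; have [/cards1P[l sl]|sJ1] := boolP (#|(s :&: J)%SET| == 1%N).
    have /setIP[_ lJ] : l \in (s :&: J)%SET by rewrite sl inE.
    rewrite (bigD1 l lJ) /= sl eqxx big1 ?addr0// => l' /andP[_ l'l].
    by rewrite ifF//; apply/negbTE; apply: contra l'l => /eqP/setP/(_ l'); rewrite !inE eqxx => ->.
  rewrite big1// => l _; rewrite ifF//; apply/negbTE.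
  by apply: contra sJ1 => /eqP ->; rewrite cards1.
apply: le_trans (ler_sum _ (fun s _ => le_first s)).
rewrite big_split /= -big_mkcond /= sumr_const -cardsE /=.
rewrite card_disjoint_groups cardJ; apply: lerD.
  rewrite -mulr_natl /stay_weight mulrA ler_wpM2l//.
    by rewrite mulr_ge0 ?ler0n.
  exact: IH.
rewrite [leRHS]exchange_big /= mulr_sumr; apply: ler_sum => l lJ.
rewrite -big_mkcond /=.
have lA : l \in labels A by move: lJ; rewrite inE.
apply: (@le_trans _ _ (\sum_(s : {set 'I_N} | (#|s| == m) && (s :&: J == [set l])%SET)
    c * \sum_(n < M) w k i.+1 n * branch_sum n (lshape (graft l (corolla (g0 l)) A)))).
  rewrite sumr_const -cardsE /= card_single_groups// cardJ.
  by rewrite -mulr_natl mulrA.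
apply: ler_sum => s /andP[/eqP sm /eqP sJ].
rewrite (first_group_single _ sm sJ uA) ler_wpM2l//.
have /setIP[ls _] : l \in (s :&: J)%SET by rewrite sJ inE.
rewrite (@lshape_graft _ _ _ _ (corolla (tnth (listing m l s))))//.
apply: IH.
  apply: uniq_labels_graft; rewrite ?listing_uniq// => x.
  by rewrite mem_listing// andbC; have /setP/(_ x) := sJ; rewrite !inE.
have := size_labels_graft l (corolla (tnth (listing m l s))) A.
rewrite labels_corolla size_tuple count_uniq_mem// lA sA mulnS /= mul1n => e.
by apply: (@addIn 1); rewrite e; lia.
Qed.

End history_sum.

Lemma sum_preimage_le d (Omega : measurableType d) (R : realType)
    (P : probability Omega R) (T : eqType) (f : Omega -> T) (s : seq T) A :
  uniq s -> (forall x, measurable (f @^-1` [set x])) -> measurable A ->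
  (\sum_(x <- s) P (A `&` f @^-1` [set x]) <= P A)%E.
Proof.
move=> us mf; elim: s us A => [|x s IH] /=; first by move=> _ A mA; rewrite big_nil.
move=> /andP[xs us] A mA; rewrite big_cons (measureDI P mA (mf x)) addeC.
rewrite leeD2r//.
have mD : measurable (A `\` f @^-1` [set x]) by exact: measurableD.
apply: le_trans (IH us _ mD); rewrite big_seq [leRHS]big_seq; apply: lee_sum => y ys.
rewrite (_ : A `&` _ = (A `\` f @^-1` [set x]) `&` f @^-1` [set y])//.
apply/seteqP; split => w /=; last by move=> [[]].
by move=> [Aw fy]; split => //; split => // fx; move: xs; rewrite -fx fy ys.
Qed.

(** * Lower bound for the law of an agent *)

Section agent_lower_bound.
Context d (E : measurableType d) (R : realType) (m N : nat).
Variable Q : R.-pker (m.-tuple E) ~> (m.-tuple E).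
Variable mu : probability E R.
Hypothesis m_gt0 : (0 < m)%N.
Context d' (Omega : measurableType d').
Variable P : probability Omega R.
Variables (K : R -> Omega -> nat) (G : nat -> Omega -> {set 'I_N}).
Variable X : nat -> Omega -> N.-tuple E.
Hypothesis XS : agent_system Q mu P K G X.

Let w k n : R := chain (stay_weight R m N) (branch_weight R m N) k 0 n.

Lemma sum_histories_le k H : measurable H ->
  (\sum_(sigma <- histories N k) P (H `&` hist_event G sigma) <= P H)%E.
Proof.
move=> mH; elim: k => [|k IH] /=; first by rewrite big_seq1 /= setIT.
rewrite big_allpairs_dep /= exchange_big /=; apply: le_trans IH.
apply: lee_sum => sigma _; under eq_bigr do rewrite setIA.
apply: sum_preimage_le; first exact: enum_uniq.
- by move=> s; exact: (system_group_measurable XS).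
- by apply: measurableI => //; exact: (hist_measurable XS).
Qed.

Lemma size_histories k sigma : sigma \in histories N k -> size sigma = k.
Proof.
elim: k sigma => [|k IH] sigma /=; first by rewrite inE => /eqP ->.
by move=> /allpairsP[[s sigma'] [_ /= /IH <- ->]].
Qed.

(** Distinct histories of length [k] are disjoint events, so dropping the cyclic ones bounds the
    probability from below; [history_sum] then starts from the one-leaf tree labelled [i]. *)
Lemma prob_state_ge k H0 (i : 'I_N) C M : clock K H0 -> measurable C ->
  ((fine (P H0) * \sum_(n < M) w k n * branch_sum Q mu C n Leaf)%:E <=
   P (H0 `&` [set v | C (tnth (X k v) i)]))%E.
Proof.
move=> cH0 mC.
set H := H0 `&` _.
have HE : H = H0 `&` X k @^-1` states_in [set i]%SET (fun=> C).
  congr (_ `&` _); apply/seteqP; split => v /=.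
    by move=> Cv j; rewrite inE => /eqP ->.
  by move=> /(_ i); rewrite inE eqxx; apply.
have mH : measurable H.
  rewrite HE; apply: measurableI; first by apply: (past_sub XS (k := 0)); exact: clock_past.
  by apply: (past_sub XS (k := k)); apply: past_state; exact: measurable_states_in.
apply: le_trans (sum_histories_le k mH).
apply: (@le_trans _ _ (fine (P H0) * history_sum Q mu C k (LLeaf m i))%:E).
  rewrite lee_fin ler_wpM2l ?fine_ge0//.
  by apply: (@history_sum_ge _ _ _ _ _ Q mu m_gt0 C k (LLeaf m i) 0 M); rewrite // muln0.
rewrite /history_sum mulr_sumr -sumEFin big_mkcond /=.
rewrite big_seq [leRHS]big_seq; apply: lee_sum => sigma sk.
case: ifP => // ac; have <- := size_histories sk.
have Js : label_set (LLeaf m i) = [set i]%SET by apply/setP => j; rewrite !inE.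
rewrite Js in ac.
rewrite HE -(size_histories sk) setIAC (prob_history m_gt0 XS cH0 ac)//.
by rewrite big_set1 /= mulrA.
Qed.

Lemma clock_law t k : (m <= N)%N -> 0 <= t ->
  fine (P (K t @^-1` [set k])) =
  expR (- (N%:R / m%:R * t)) * exp_coeff (N%:R / m%:R * t) k.
Proof.
(* At [t = 0] the law comes from [poisson_init], as [poisson_increments] only covers strictly
   increasing times. *)
move=> mN; rewrite le_eqVlt => /predU1P[<-|t0].
  rewrite mulr0 oppr0 expR0 mul1r /exp_coeff /=.
  have K0 := poisson_init (system_clock XS).
  case: k => [|k].
    rewrite (_ : _ @^-1` _ = setT) ?probability_setT ?fact0 ?expr0 ?divr1//.
    by apply/seteqP; split => v //= _.
  rewrite (_ : _ @^-1` _ = set0) ?measure0 ?expr0n ?mul0r//.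
  by apply/seteqP; split => v //=; rewrite K0.
have lt0 : 0 < N%:R / m%:R * t :> R.
  by rewrite mulr_gt0 ?divr_gt0 ?ltr0n// (leq_trans m_gt0).
have := @poisson_increments _ _ _ _ _ _ (system_clock XS) 1
  (fun j => if j is 0 then 0 else t) (fun=> k) (lexx _).
rewrite big_ord1 subr0 /poisson_pmf lt0 => Pk.
rewrite (_ : _ @^-1` _ = [set v | forall j, (j < 1)%N ->
    K (if j.+1 is 0 then 0 else t) v =
    (K (if j is 0 then 0 else t) v + k)%N]).
  by rewrite Pk/= 1?mulrC// => -[].
apply/seteqP; split => v /=.
  by move=> Kv [|//] _; rewrite (poisson_init (system_clock XS)).
by move=> /(_ 0 isT); rewrite (poisson_init (system_clock XS)).
Qed.

Lemma agent_state_ge t (i : 'I_N) C M n0 : (m <= N)%N -> 0 <= t -> measurable C ->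
  measurable [set v | C (agent_state K X i t v)] ->
  ((\sum_(k < n0) expR (- (N%:R / m%:R * t)) * exp_coeff (N%:R / m%:R * t) k *
     \sum_(n < M) w k n * branch_sum Q mu C n Leaf)%:E <=
   P [set v | C (agent_state K X i t v)])%E.
Proof.
move=> mN t0 mC mA.
apply: le_trans (sum_preimage_le P (f := K t) (iota_uniq 0 n0) _ mA); last first.
  by move=> k; exact: (poisson_measurable (system_clock XS)).
rewrite -sumEFin (_ : iota 0 n0 = index_iota 0 n0) ?big_mkord; last first.
  by rewrite /index_iota subn0.
apply: lee_sum => k _; rewrite -clock_law//.
apply: le_trans (prob_state_ge _ i M _ mC) _.
  by apply: sub_sigma_algebra; exists t, k.
rewrite (_ : _ `&` _ = [set v | C (agent_state K X i t v)] `&` K t @^-1` [set (k : nat)])//.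
by apply/seteqP; split => v /= [] + +; rewrite /agent_state => a b;
  split => //; rewrite ?a ?b // -?a -?b.
Qed.

End agent_lower_bound.

(** * Uniqueness for the birth equations *)

Lemma is_derive1_expR_lin (R : realType) (c x : R) :
  is_derive x 1 (fun y => expR (c * y)) (c * expR (c * x)).
Proof.
have dl : is_derive x 1 (fun y : R => c * y) c.
  apply: is_derive_eq (is_deriveM (is_derive_cst c x 1) (is_derive_id x 1)) _.
  by rewrite /GRing.scale /=; ring.
by rewrite mulrC; exact: is_derive1_comp (is_derive_expR (c * x)) dl.
Qed.

Lemma is_derive1_ext (R : realType) (f g : R -> R) (x a : R) :
  f =1 g -> is_derive x 1 f a -> is_derive x 1 g a.
Proof. by move=> /funext ->. Qed.

(** The integrating factor [expR (c * s)] gives a function with zero derivative at positive times;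
    the mean value theorem needs only continuity at the endpoint 0. *)
Lemma decay_eq0 (R : realType) (f : R -> R) (c t : R) :
  {within `[0, +oo[, continuous f} -> f 0 = 0 -> 0 <= t ->
  (forall s : R, 0 < s -> is_derive s 1 f (- (c * f s))) -> f t = 0.
Proof.
move=> cf f0 t0 df; pose g (s : R) := f s * expR (c * s).
have dg (s : R) : 0 < s -> is_derive s 1 g 0.
  move=> s0; have d1 := df s s0; have d2 := is_derive1_expR_lin c s.
  apply: is_derive_eq (is_deriveM d1 d2) _.
  by rewrite /GRing.scale /=; ring.
have cg : {within `[0, t], continuous g}.
  have cft : {within `[0, t], continuous f}.
    by apply: continuous_subspaceW cf => s /=; rewrite !in_itv /= => /andP[->].
  have ce : {within `[0, t], continuous (fun s => expR (c * s))}.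
    apply: continuous_subspaceT => s; apply: continuous_comp; last exact: continuous_expR.
    exact: mulrl_continuous.
  by move=> s; apply: cvgM; [exact: cft|exact: ce].
have [s _] : exists2 s, s \in `[0, t]%R & g t - g 0 = 0 * (t - 0).
  apply: (@MVT_segment _ g (fun=> 0)) => // s; rewrite in_itv /= => /andP[s0 _].
  exact: dg.
rewrite mul0r /g f0 mul0r subr0 => /eqP.
by rewrite mulf_eq0 (gt_eqF (expR_gt0 _)) orbF => /eqP.
Qed.

(** The system is triangular: once the weights of index [n] agree, the difference at [n.+1] solves a
    homogeneous linear equation with zero initial value. *)
Lemma birth_weights_unique (R : realType) m (p p' : nat -> R -> R) :
  birth_weights m p -> birth_weights m p' ->
  forall n (t : R), 0 <= t -> p n t = p' n t.
Proof.
move=> bp bp'; have cB n : {within `[0, +oo[, continuous (p n - p' n)}.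
  move=> s; apply: cvgB; [exact: (birth_continuous bp)|exact: (birth_continuous bp')].
have B0 n : (p n - p' n) 0 = 0.
  by rewrite -[LHS]/(p n 0 - p' n 0) (birth_init bp) (birth_init bp') subrr.
elim=> [|n IH] t t0; apply/eqP; rewrite -subr_eq0; apply/eqP.
  apply: (@decay_eq0 _ (p 0%N - p' 0%N) 1) => // s s0.
  have d1 := birth_ode0 bp s0; have d2 := birth_ode0 bp' s0.
  apply: is_derive_eq (is_deriveB d1 d2) _.
  rewrite -[(_ - _) s]/(p 0%N s - p' 0%N s); ring.
apply: (@decay_eq0 _ (p n.+1 - p' n.+1) ((m - 1) * n.+1 + 1)%N%:R) => // s s0.
have d1 := birth_odeS bp n s0; have d2 := birth_odeS bp' n s0.
apply: is_derive_eq (is_deriveB d1 d2) _.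
rewrite -[(p _ - _) s]/(p n.+1 s - p' n.+1 s) IH ?ltW//; ring.
Qed.

Lemma num_treesS m n : num_trees m n.+1 = (num_trees m n * ((m - 1) * n + 1))%N.
Proof.
case: n => [|n]; first by rewrite /num_trees !big_geq// muln0.
by rewrite /num_trees [LHS]big_nat_recr.
Qed.

(** * Chain weights as sums of powers *)

Section divided_differences.
Variable R : realType.

(* The coefficients of the divided differences that express the laws of a pure
   birth chain: [A l] is the rate of leaving [l] and [r l] that of moving to [l + 1]. *)
Fixpoint coef (A r : nat -> R) (n : nat) : nat -> R :=
  if n is n'.+1 then
    let b l := r n' * coef A r n' l / (A n - A l) in
    fun l => if l == n then - \sum_(j < n) b j else b l
  else fun=> 1.

Lemma coef_lt A r n l : (l < n.+1)%N ->
  coef A r n.+1 l = r n * coef A r n l / (A n.+1 - A l).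
Proof. by move=> ln /=; rewrite ltn_eqF. Qed.

Lemma coef_diag A r n : coef A r n.+1 n.+1 = - \sum_(l < n.+1) coef A r n.+1 l.
Proof.
rewrite /= eqxx; congr (- _); apply: eq_bigr => l _.
by rewrite (ltn_eqF (ltn_ord l)).
Qed.

Lemma sum_coefS A r n : \sum_(l < n.+2) coef A r n.+1 l = 0.
Proof.
by rewrite big_ord_recr [nat_of_ord ord_max]/= coef_diag; exact: subrr.
Qed.

Lemma chain0 (a r : nat -> R) k i : chain a r k i 0 = a i ^+ k.
Proof. by elim: k => [|k IH] /=; rewrite ?expr0// IH addr0 exprS. Qed.

Lemma chainS (a r : nat -> R) k i n :
  chain a r k.+1 i n.+1 = a i * chain a r k i n.+1 + r i * chain a r k i.+1 n.
Proof. by []. Qed.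

(** [chain] splits paths at their first step; splitting at the last one keeps the starting point
    fixed, which the induction of [chain_coef] from state 0 requires. *)
Lemma chain_fwd (a r : nat -> R) k i n :
  chain a r k.+1 i n.+1 =
  a (i + n.+1)%N * chain a r k i n.+1 + r (i + n)%N * chain a r k i n.
Proof.
elim: k i n => [|k IH] i n.
  by rewrite /= mulr0 add0r mulr0 add0r; case: n => [|n]; rewrite ?addn0 ?mulr0.
rewrite [LHS]chainS [X in a i * X]IH; case: n => [|n].
  rewrite !chain0 chainS chain0 addn0 addn1 !exprS; ring.
by rewrite [X in r i * X]IH !chainS !addSnnS; ring.
Qed.

(** Diagonalization of a bidiagonal matrix with distinct eigenvalues [1 - A l / lam]. The
    coefficients below the diagonal solve the last-step recursion, and the diagonal one is chosen so
    that the sum vanishes at [k = 0]. *)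
Lemma chain_coef (A r : nat -> R) lam n k : lam != 0 ->
  (forall l n', (l < n')%N -> (n' <= n)%N -> A n' - A l != 0) ->
  chain (fun l => 1 - A l / lam) (fun l => r l / lam) k 0 n =
  \sum_(l < n.+1) coef A r n l * (1 - A l / lam) ^+ k.
Proof.
move=> lam0; elim: n k => [|n IH] k dA.
  by rewrite chain0 big_ord1 /= mul1r.
have {}IH k' := IH k' (fun l n' ln n'n => dA l n' ln (leqW n'n)).
elim: k => [|k IHk].
  under eq_bigr do rewrite expr0 mulr1.
  by rewrite sum_coefS.
rewrite chain_fwd IHk IH !add0n.
rewrite big_ord_recr [in RHS]big_ord_recr mulrDr addrAC; congr (_ + _); last first.
  by rewrite exprS /=; ring.
rewrite !mulr_sumr -big_split; apply: eq_bigr => l _.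
have dl := dA l n.+1 (ltn_ord l) (leqnn _).
rewrite (coef_lt _ _ (ltn_ord l)) exprS /=; field.
by rewrite lam0 dl.
Qed.

End divided_differences.

(** * Two explicit forms of the limiting weights *)

Section explicit_weights.
Context (R : realType) (m : nat).
Hypothesis m_ge2 : (2 <= m)%N.

Definition leaves n : R := ((m - 1) * n + 1)%N%:R.

Lemma leavesS n : leaves n.+1 = leaves n + (m - 1)%N%:R.
Proof. by rewrite /leaves -natrD mulnS; congr _%:R; lia. Qed.

Lemma leavesE n : leaves n = (m - 1)%N%:R * n%:R + 1.
Proof. by rewrite /leaves natrD natrM. Qed.

Lemma leaves_inj l n : (l < n)%N -> leaves n - leaves l != 0.
Proof.
move=> ln; rewrite subr_eq0 eqr_nat eqn_add2r eqn_pmul2l ?(gtn_eqF ln)//; lia.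
Qed.

(** The form produced by the limit in [N]. The coefficients use unit rate for each single leaf, and
    [num_trees] restores the product of the birth rates. *)
Definition coef_weights n (t : R) : R := (num_trees m n)%:R *
  \sum_(l < n.+1) coef leaves (fun=> 1) n l * expR (- leaves l * t).

Lemma derive_exp_sum n (c A : nat -> R) (t : R) :
  is_derive t 1 (fun s : R => \sum_(l < n) c l * expR (A l * s))
    (\sum_(l < n) A l * c l * expR (A l * t)).
Proof.
have d1 (l : 'I_n) : is_derive t 1 (cst (c l) * (fun s : R => expR (A l * s)))
    (A l * c l * expR (A l * t)).
  have d2 := is_derive1_expR_lin (A l) t.
  apply: is_derive_eq (is_deriveM (is_derive_cst (c l) t 1) d2) _.
  by rewrite /GRing.scale /=; ring.
have := is_derive_sum d1; apply: is_derive1_ext => s.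
by rewrite fct_sumE.
Qed.

Lemma derive_scale (f : R -> R) (k t a : R) :
  is_derive t 1 f a -> is_derive t 1 (fun s => k * f s) (k * a).
Proof.
move=> df; apply: is_derive_eq (is_deriveM (is_derive_cst k t 1) df) _.
by rewrite /GRing.scale /=; ring.
Qed.

Lemma derivable_continuous_within (f : R -> R) (df : R -> R) A :
  (forall t : R, is_derive t 1 f (df t)) -> {within A, continuous f}.
Proof.
move=> d; apply: continuous_subspaceT => t.
by apply: differentiable_continuous; apply/derivable1_diffP; have [] := d t.
Qed.

Lemma coef_weights_birth : birth_weights m coef_weights.
Proof.
pose c n := coef leaves (fun=> 1) n.
have d n (t : R) : is_derive t 1 (coef_weights n) ((num_trees m n)%:R *
    \sum_(l < n.+1) - leaves l * c n l * expR (- leaves l * t)).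
  exact/derive_scale/(derive_exp_sum n.+1 (c n) (fun l => - leaves l)).
split.
- by move=> n; exact: derivable_continuous_within (d n).
- case=> [|n].
    by rewrite /coef_weights big_ord1 /= /num_trees big_geq// mulr0 expR0 !mulr1.
  rewrite /coef_weights (eq_bigr (fun l : 'I_n.+2 => c n.+1 l)).
    by rewrite sum_coefS mulr0.
  by move=> l _; rewrite mulr0 expR0 mulr1.
- move=> t _; apply: is_derive_eq (d 0%N t) _.
  by rewrite /coef_weights !big_ord1 /c /leaves muln0 add0n /=; ring.
- move=> n t _; apply: is_derive_eq (d n.+1 t) _.
  rewrite /coef_weights num_treesS natrM -/(leaves n) -/(leaves n.+1).
  rewrite [X in _ = _ - _ * (_ * X)](eq_bigr (fun l : 'I_n.+2 =>
     c n.+1 l * expR (- leaves l * t)))//.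
  (* The terms of index [n.+1] agree on both sides; the lower ones follow from the recursion
     [coef_lt]. *)
  rewrite [in LHS]big_ord_recr [X in _ = _ - _ * (_ * X)]big_ord_recr /=.
  set e := c n.+1 n.+1.
  rewrite [X in _ * (X + _) = _](_ : _ =
    \sum_(l < n.+1) c n l * expR (- leaves l * t) -
    leaves n.+1 * \sum_(l < n.+1) c n.+1 l * expR (- leaves l * t)).
    rewrite /c; ring.
  rewrite mulr_sumr -sumrB; apply: eq_bigr => l _.
  rewrite /c (coef_lt _ _ (ltn_ord l)).
  by move: (leaves _) (leaves _) (leaves_inj (ltn_ord l)) => x y xy; field.
Qed.

Definition decay (t : R) : R := 1 - expR (- (m - 1)%N%:R * t).

(** The negative binomial law of index [1 / (m - 1)] and failure probability [decay t]. This form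
    shows positivity and geometric decay, which the alternating sum [coef_weights] hides. *)
Definition closed_weights n (t : R) : R :=
  (num_trees m n)%:R / (n`!%:R * (m - 1)%N%:R ^+ n) * (expR (- t) * decay t ^+ n).

Let fact_neq0 n : n`!%:R != 0 :> R.
Proof. by rewrite pnatr_eq0 -lt0n fact_gt0. Qed.

Let m1_neq0 : (m - 1)%N%:R != 0 :> R.
Proof. by rewrite pnatr_eq0; lia. Qed.

Lemma closed_weights_birth : birth_weights m closed_weights.
Proof.
have de (t : R) : is_derive t 1 (fun s : R => expR (- s)) (- expR (- t)).
  have := is_derive1_expR_lin (-1) t; rewrite !mulN1r.
  by apply: is_derive1_ext => s; rewrite mulN1r.
have dd (t : R) : is_derive t 1 decay ((m - 1)%N%:R * (1 - decay t)).
  have de1 := is_derive1_expR_lin (- (m - 1)%N%:R) t.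
  have dB := is_deriveB (is_derive_cst (1 : R) t 1) de1.
  by apply: is_derive_eq dB _; rewrite /decay; ring.
have d n (t : R) : is_derive t 1 (closed_weights n)
    ((num_trees m n)%:R / (n`!%:R * (m - 1)%N%:R ^+ n) * (expR (- t) *
     (n%:R * decay t ^+ n.-1 * ((m - 1)%N%:R * (1 - decay t)) - decay t ^+ n))).
  apply: derive_scale.
  have dX := @is_deriveX _ _ decay n t 1 _ (dd t).
  have := is_deriveM (de t) dX.
  rewrite /GRing.scale /= => dM.
  apply: (@is_derive1_ext _ ((fun s => expR (- s)) * decay ^+ n)) => [s|].
    by rewrite exprfctE.
  by apply: is_derive_eq dM _; rewrite exprfctE; ring.
split.
- by move=> n; exact: derivable_continuous_within (d n).
- case=> [|n]; rewrite /closed_weights /decay mulr0 oppr0 expR0 subrr.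
    by rewrite /num_trees big_geq// fact0 !expr0 !mulr1 divr1.
  by rewrite expr0n !mulr0.
- move=> t _; apply: is_derive_eq (d 0%N t) _.
  by rewrite /closed_weights /= expr0; ring.
- move=> n t _; apply: is_derive_eq (d n.+1 t) _.
  rewrite /closed_weights num_treesS natrM -/(leaves n) -/(leaves n.+1).
  rewrite leavesS leavesE factS natrM !exprS /=.
  have := m1_neq0; have := fact_neq0 n; set u := (m - 1)%N%:R => u0 f0.
  have n0 : n%:R + 1 != 0 :> R by rewrite natr1 pnatr_eq0.
  rewrite -(natr1 n); field.
  by rewrite n0 f0 u0 expf_neq0.
Qed.

Lemma decay_ge0 t : 0 <= t -> 0 <= decay t.
Proof.
move=> t0; rewrite /decay subr_ge0 -expR0 ler_expR mulNr oppr_le0.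
by rewrite mulr_ge0.
Qed.

Lemma decay_lt1 t : decay t < 1.
Proof. by rewrite /decay ltrBlDr ltrDl expR_gt0. Qed.

Lemma ler_decay s t : s <= t -> decay s <= decay t.
Proof.
move=> st; rewrite /decay lerD2l lerN2 ler_expR !mulNr lerN2.
exact: ler_wpM2l.
Qed.

Lemma closed_weights_ge0 n t : 0 <= t -> 0 <= closed_weights n t.
Proof.
move=> t0; rewrite /closed_weights mulr_ge0//.
by rewrite mulr_ge0 ?expR_ge0 ?exprn_ge0 ?decay_ge0.
Qed.

Lemma num_trees_le n : (num_trees m n <= n`! * (m - 1) ^ n)%N.
Proof.
elim: n => [|n IH]; first by rewrite /num_trees big_geq.
rewrite num_treesS factS expnS.
apply: (@leq_trans ((n`! * (m - 1) ^ n) * ((m - 1) * n.+1))); last nia.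
by apply: leq_mul => //; nia.
Qed.

Lemma closed_weights_le n t : 0 <= t -> closed_weights n t <= decay t ^+ n.
Proof.
move=> t0; rewrite /closed_weights -[leRHS]mul1r; apply: ler_pM.
- by rewrite divr_ge0 ?mulr_ge0 ?exprn_ge0.
- by rewrite mulr_ge0 ?expR_ge0 ?exprn_ge0 ?decay_ge0.
- rewrite ler_pdivrMr ?mul1r.
    by rewrite -natrX -natrM ler_nat num_trees_le.
  by rewrite mulr_gt0 ?ltr0n ?fact_gt0 ?exprn_gt0// ltr0n; lia.
- rewrite ler_piMl ?exprn_ge0 ?decay_ge0//.
  by rewrite -expR0 ler_expR oppr_le0.
Qed.

(** With [y] the square root of [z], the product [n * y ^ n] is at most the sum of [y ^ k] over
    [k < n], hence at most [1 / (1 - y)]; the other factor [y ^ n] tends to 0. *)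
Lemma natmul_expr_cvg0 (z : R) : 0 <= z < 1 -> n%:R * z ^+ n @[n --> \oo] --> (0 : R).
Proof.
move=> /andP[z0 z1]; set y := Num.sqrt z.
have y0 : 0 <= y by exact: sqrtr_ge0.
have y1 : y < 1 by rewrite -sqrtr1 ltr_sqrt.
have bound n : n%:R * y ^+ n * (1 - y) <= 1 - y ^+ n.
  elim: n => [|n IH]; first by rewrite mul0r mul0r expr0 subrr.
  have h1 := ler_wpM2l y0 IH.
  have h2 : y ^+ n.+1 * (1 - y) <= 1 - y.
    by rewrite ler_piMl ?subr_ge0 ?(ltW y1)// exprn_ile1// ltW.
  move: h1 h2; rewrite -natr1 !exprS; lra.
apply: (@squeeze_cvgr _ _ _ _ (cst 0) (fun n => (1 - y)^-1 * y ^+ n)).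
- apply: nearW => n /=; rewrite mulr_ge0 ?exprn_ge0//=.
  rewrite -(sqr_sqrtr z0) -/y -exprM mulnC exprM expr2 mulrA ler_wpM2r ?exprn_ge0//.
  rewrite -div1r ler_pdivlMr ?subr_gt0//; apply: le_trans (bound n) _.
  by rewrite gerBl exprn_ge0.
- exact: cvg_cst.
- rewrite -[X in _ --> X](mulr0 (1 - y)^-1); apply: cvgM; first exact: cvg_cst.
  by apply: cvg_expr; rewrite ger0_norm.
Qed.

(** The forward equations telescope, so the mass of the states up to [M] is lost only through the
    outflow at [M]. The mean value theorem and the geometric bound control this loss, which excludes
    explosion. *)
Lemma sum_closed_weights M t : 0 <= t ->
  1 - t * leaves M * decay t ^+ M <= \sum_(n < M.+1) closed_weights n t <= 1.
Proof.
move=> t0; have bw := closed_weights_birth.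
pose S (s : R) := \sum_(n < M.+1) closed_weights n s.
have dS (s : R) : 0 < s -> is_derive s 1 S (- (leaves M * closed_weights M s)).
  move=> s0; rewrite /S; elim: (M) => [|k IH].
    apply: (@is_derive1_ext _ (closed_weights 0)) => [x|]; first by rewrite big_ord1.
    by apply: is_derive_eq (birth_ode0 bw s0) _; rewrite /leaves muln0 mul1r.
  apply: (@is_derive1_ext _ ((fun s => \sum_(n < k.+1) closed_weights n s) +
    closed_weights k.+1)) => [x|]; first by rewrite [RHS]big_ord_recr.
  apply: is_derive_eq (is_deriveD IH (birth_odeS bw k s0)) _.
  by rewrite /leaves; ring.
have cS : {within `[0, t], continuous S}.
  have cw n : {within `[0, t], continuous (closed_weights n)}.
    apply: continuous_subspaceW (@birth_continuous _ _ _ bw n).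
    by move=> x /=; rewrite !in_itv /= => /andP[->].
  move=> s; apply: cvg_big => [|n _]; first exact: add_continuous.
  exact: cw.
have [s] : exists2 s, s \in `[0, t]%R &
    S t - S 0 = - (leaves M * closed_weights M s) * (t - 0).
  apply: (@MVT_segment _ S (fun s => - (leaves M * closed_weights M s))) => //.
  by move=> s; rewrite in_itv /= => /andP[s0 _]; exact: dS.
rewrite in_itv /= subr0 => /andP[s0 st].
have -> : S 0 = 1.
  rewrite /S big_ord_recl (birth_init bw) big1 ?addr0// => n _.
  by rewrite (birth_init bw).
move=> e; have St : S t = 1 - leaves M * closed_weights M s * t.
  by move/eqP: e; rewrite subr_eq => /eqP ->; ring.
rewrite -/(S t) St.
have lM : 0 <= leaves M by exact: ler0n.
have cM := closed_weights_ge0 M s0.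
apply/andP; split; last by rewrite gerBl mulr_ge0// mulr_ge0.
rewrite lerD2l lerN2 mulrC -mulrA ler_wpM2l// ler_wpM2l//.
apply: le_trans (closed_weights_le M s0) _.
by rewrite lerXn2r ?nnegrE ?decay_ge0 ?ler_decay.
Qed.

Lemma sum_closed_weights_cvg t : 0 <= t ->
  \sum_(n < M.+1) closed_weights n t @[M --> \oo] --> (1 : R).
Proof.
move=> t0.
apply: (@squeeze_cvgr _ _ _ _
  (fun M => 1 - t * leaves M * decay t ^+ M) (cst 1)).
- by apply: nearW => M; exact: sum_closed_weights.
- have z01 : 0 <= decay t < 1 by rewrite decay_ge0// decay_lt1.
  have h1 := natmul_expr_cvg0 z01.
  have h2 : decay t ^+ M @[M --> \oo] --> (0 : R).
    by apply: cvg_expr; rewrite ger0_norm ?decay_lt1 ?decay_ge0.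
  have : (1 - (t * (m - 1)%N%:R * (M%:R * decay t ^+ M) + t * decay t ^+ M))
      @[M --> \oo] --> 1 - (t * (m - 1)%N%:R * 0 + t * 0).
    apply: cvgB; first exact: cvg_cst.
    by apply: cvgD; apply: cvgM => //; exact: cvg_cst.
  rewrite !mulr0 addr0 subr0; apply: cvg_trans; apply: near_eq_cvg.
  by apply: nearW => M; rewrite leavesE; ring.
- exact: cvg_cst.
Qed.

End explicit_weights.

(** * Convergence of the rates as the population grows *)

Section large_population.
Context (R : realType) (m : nat).
Hypothesis m_gt0 : (0 < m)%N.

(** Passing from [q] to [q.+1] multiplies the ratio by [1 - j / (n - q)], which tends to 1. *)
Lemma bin_ratio_cvg q j :
  'C(n - j, q)%:R / 'C(n, q)%:R @[n --> \oo] --> (1 : R).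
Proof.
elim: q => [|q IH].
  by under eq_fun do rewrite !bin0 divr1; exact: cvg_cst.
have inv0 : (n - q)%:R^-1 @[n --> \oo] --> (0 : R).
  rewrite -(cvg_shiftn q.+1).
  under eq_fun do rewrite addnS -addSn addnK.
  exact: cvg_harmonic.
have : 'C(n - j, q)%:R / 'C(n, q)%:R * (1 - j%:R * (n - q)%:R^-1)
    @[n --> \oo] --> (1 : R) * (1 - j%:R * 0).
  apply: cvgM => //; apply: cvgB; first exact: cvg_cst.
  by apply: cvgM => //; exact: cvg_cst.
rewrite mulr0 subr0 mulr1; apply: cvg_trans; apply: near_eq_cvg.
exists (j + q).+1 => // n /= jqn.
have nq : (n - q)%:R != 0 :> R by rewrite pnatr_eq0; lia.
have q1 : q.+1%:R != 0 :> R by rewrite pnatr_eq0.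
have cn : 'C(n, q)%:R != 0 :> R by rewrite pnatr_eq0 -lt0n bin_gt0; lia.
have binR n' : 'C(n', q.+1)%:R = (n' - q)%:R / q.+1%:R * 'C(n', q)%:R :> R.
  by apply: (mulfI q1); rewrite mulrA [_ * (_ / _)]mulrC divfK// -!natrM mul_bin_left.
rewrite !binR [(n - j - q)%N]subnAC (@natrB _ (n - q) j); last by lia.
move: (n - q)%:R q.+1%:R nq q1 {binR} cn => x y x0 y0 c0.
by field; rewrite x0 y0 c0.
Qed.

(** The shift by one keeps the meeting rate nonzero and gives the factor [rate N / 'C(N.+1, m)] the
    simple form of [rate_bin]. *)
Let agents N := N.+1.
Let rate N : R := (agents N)%:R / m%:R.

(** Rates per unit time: of leaving state [i], meetings that close a cycle included, and, for
    [scaled_branch], of branching at one given leaf. *)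
Definition scaled_rate N i : R := rate N * (1 - stay_weight R m (agents N) i).
Definition scaled_branch N i : R := rate N * branch_weight R m (agents N) i.

Let rate_bin N : (m <= N.+1)%N -> rate N / 'C(agents N, m)%:R = ('C(N, m - 1)%:R)^-1.
Proof.
move=> mN; rewrite /rate /agents.
have e : N.+1%:R * 'C(N, m - 1)%:R = m%:R * 'C(N.+1, m)%:R :> R.
  by rewrite -!natrM (mul_bin_diag N.+1 (m - 1)) subn1 prednK.
have m0 : m%:R != 0 :> R by rewrite pnatr_eq0 -lt0n.
have c0 : 'C(N, m - 1)%:R != 0 :> R by rewrite pnatr_eq0 -lt0n bin_gt0; lia.
have c1 : 'C(N.+1, m)%:R != 0 :> R by rewrite pnatr_eq0 -lt0n bin_gt0.
by apply: (mulIf c0); rewrite mulVf// mulrAC [_ / m%:R * _]mulrAC e; field; rewrite m0 c1.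
Qed.

Lemma scaled_branch_cvg i : scaled_branch N i @[N --> \oo] --> (1 : R).
Proof.
have := @bin_ratio_cvg (m - 1) ((m - 1) * i); apply: cvg_trans; apply: near_eq_cvg.
exists m => // N /= mN.
rewrite /scaled_branch /branch_weight mulrCA rate_bin; last by lia.
by rewrite addn1 subSS.
Qed.

Let bin_telescope N j : (j <= N.+1)%N ->
  ('C(N.+1, m) = 'C(N.+1 - j, m) + \sum_(i < j) 'C(N - i, m - 1))%N.
Proof.
elim: j => [|j IH] jN; first by rewrite big_ord0 subn0 addn0.
rewrite big_ord_recr /= [LHS]IH; last exact: ltnW.
have -> : 'C(N.+1 - j, m) = ('C(N.+1 - j.+1, m) + 'C(N - j, m - 1))%N.
  by rewrite subSn// subSS; case: (m) m_gt0 => // q _; rewrite binS subn1.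
by rewrite addnAC addnA.
Qed.

(** By [bin_telescope], an iterated Pascal rule, the groups that meet the [j] leaves are counted by
    a sum of [j] binomials, and each divided by ['C(N, m - 1)] tends to 1. *)
Lemma scaled_rate_cvg i : scaled_rate N i @[N --> \oo] --> leaves R m i.
Proof.
set j := ((m - 1) * i + 1)%N.
have : \sum_(k < j) ('C(N - k, m - 1)%:R / 'C(N, m - 1)%:R) @[N --> \oo] -->
    \sum_(k < j) (1 : R).
  by apply: cvg_big => [|k _]; [exact: add_continuous|exact: bin_ratio_cvg].
rewrite sumr_const card_ord; apply: cvg_trans; apply: near_eq_cvg.
exists (m + j)%N => // N /= mjN.
rewrite -mulr_suml -natr_sum -rate_bin; last by lia.
have -> : (\sum_(k < j) 'C(N - k, m - 1) = 'C(N.+1, m) - 'C(N.+1 - j, m))%N.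
  by rewrite (@bin_telescope N j) ?addKn//; lia.
rewrite natrB; last by rewrite leq_bin2l// leq_subr.
have c1 : 'C(N.+1, m)%:R != 0 :> R by rewrite pnatr_eq0 -lt0n bin_gt0; lia.
by rewrite /scaled_rate /stay_weight -/j; field; rewrite c1.
Qed.

Hypothesis m_ge2 : (2 <= m)%N.

Lemma coef_cvg n l : (l <= n)%N ->
  coef (scaled_rate N) (scaled_branch N) n l @[N --> \oo] -->
  coef (leaves R m) (fun=> 1) n l.
Proof.
elim: n l => [|n IH] l; first by move=> _; exact: cvg_cst.
have lt_cvg k : (k < n.+1)%N ->
    coef (scaled_rate N) (scaled_branch N) n.+1 k @[N --> \oo] -->
    coef (leaves R m) (fun=> 1) n.+1 k.
  move=> kn; rewrite coef_lt//; under eq_fun do rewrite coef_lt//.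
  apply: cvgM; first by apply: cvgM; [exact: scaled_branch_cvg|exact: IH].
  apply: cvgV; first exact: leaves_inj.
  by apply: cvgB; exact: scaled_rate_cvg.
rewrite leq_eqVlt => /predU1P[->|]; last exact: lt_cvg.
rewrite coef_diag; under eq_fun do rewrite coef_diag.
apply: cvgN; apply: cvg_big => [|k _]; first exact: add_continuous.
exact: lt_cvg.
Qed.

(** The limits of the rates are distinct, and only finitely many pairs of indices lie below [M].
    This is what allows [chain_coef] to be used for large populations. *)
Lemma scaled_rate_distinct M : \forall N \near \oo, forall l n,
  (l < n)%N -> (n <= M)%N -> scaled_rate N n - scaled_rate N l != 0.
Proof.
have h : \forall N \near \oo, forall (n : 'I_M.+1), forall (l : 'I_M.+1), (l < n)%N ->
    scaled_rate N n - scaled_rate N l != 0.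
  apply: filter_forall => n; apply: filter_forall => l.
  have [ln|_] := boolP (l < n)%N; last by apply: nearW.
  have := cvgr_neq0 _ (cvgB (@scaled_rate_cvg n) (@scaled_rate_cvg l)) (leaves_inj _ m_ge2 ln).
  by move=> h; near=> N => _; near: N; exact: h.
near=> N => l n ln nM.
have hN : forall n l : 'I_M.+1, (l < n)%N -> scaled_rate N n - scaled_rate N l != 0.
  by near: N; exact: h.
exact: (hN (Ordinal (nM : (n < M.+1)%N)) (Ordinal (ltn_trans ln (nM : (n < M.+1)%N)))).
Unshelve. all: by end_near. Qed.

End large_population.

Lemma measurable_agent_state d (E : measurableType d) (R : realType) (m N : nat)
    (Q : R.-pker (m.-tuple E) ~> (m.-tuple E)) (mu : probability E R)
    d' (Omega : measurableType d') (P : probability Omega R)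
    (K : R -> Omega -> nat) (G : nat -> Omega -> {set 'I_N})
    (X : nat -> Omega -> N.-tuple E) t i C :
  agent_system Q mu P K G X -> 0 <= t -> measurable C ->
  measurable [set v | C (agent_state K X i t v)].
Proof.
move=> XS t0 mC.
rewrite (_ : [set v | _] = \bigcup_k (K t @^-1` [set k] `&`
    ((fun x => tnth x i) \o X k) @^-1` C)).
  apply: bigcupT_measurable => k; apply: measurableI.
    exact: (poisson_measurable (system_clock XS)).
  rewrite -[X in measurable X]setTI.
  apply: measurableT_comp => //; last exact: (system_state_measurable XS).
  exact: measurable_tnth.
apply/seteqP; split => v /=; first by move=> Cv; exists (K t v).
by move=> [k _ [/= Kk]]; rewrite /agent_state Kk.
Qed.

(** The Poisson generating function: averaged over the clock, the powers of [chain_coef] become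
    exponentials in time. *)
Lemma exp_coeff_sum_cvg (R : realType) (x a : R) :
  expR (- x) * \sum_(k < n) exp_coeff x k * a ^+ k @[n --> \oo] -->
  expR (- (x * (1 - a))).
Proof.
have -> : expR (- (x * (1 - a))) = expR (- x) * expR (x * a).
  by rewrite -expRD; congr expR; ring.
apply: cvgM; first exact: cvg_cst.
have := is_cvg_series_exp_coeff (x * a); rewrite -/(expR (x * a)).
apply: cvg_trans; apply: near_eq_cvg; apply: nearW => n.
rewrite /series /= big_mkord; apply: eq_bigr => k _.
by rewrite /exp_coeff /= exprMn; ring.
Qed.

(** * Convergence in total variation *)

Section convergence.
Context (R : realType) d (E : measurableType d) (m : nat).
Hypothesis m_ge2 : (2 <= m)%N.
Variable Q : R.-pker (m.-tuple E) ~> (m.-tuple E).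
Variable mu : probability E R.
Variable t : R.
Hypothesis t_ge0 : 0 <= t.

Let m_gt0 : (0 < m)%N. Proof. exact: ltnW. Qed.

(** Weight given to each single ordered tree with [n] internal nodes, after averaging over the
    clock; [limit_weight] is its limit. *)
Definition population_weight N n : R :=
  \sum_(l < n.+1) coef (scaled_rate R m N) (scaled_branch R m N) n l *
    expR (- scaled_rate R m N l * t).

Definition limit_weight n : R :=
  \sum_(l < n.+1) coef (leaves R m) (fun=> 1) n l * expR (- leaves R m l * t).

Lemma population_weight_cvg n :
  population_weight N n @[N --> \oo] --> limit_weight n.
Proof.
apply: cvg_big => [|l _]; first exact: add_continuous.
apply: cvgM; first by apply: coef_cvg => //; rewrite -ltnS.
apply: continuous_cvg; first exact: continuous_expR.
by apply: cvgM; [apply: cvgN; exact: scaled_rate_cvg|exact: cvg_cst].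
Qed.

(** With [M] fixed, the cut [n0] on the number of meetings in [agent_state_ge] tends to infinity;
    after exchanging finite sums only Poisson series of powers remain. *)
Lemma agent_law_ge N M nu C : (m <= N.+1)%N ->
  (forall l n, (l < n)%N -> (n <= M)%N ->
    scaled_rate R m N n - scaled_rate R m N l != 0) ->
  agent_law N.+1 Q mu t nu -> measurable C ->
  \sum_(n < M) population_weight N n * branch_sum Q mu C n Leaf <= fine (nu C).
Proof.
move=> mN dist_rate [d' [W [P [K [G [X [XS [i nuE]]]]]]]] mC.
have mA := measurable_agent_state i XS t_ge0 mC.
set lam : R := N.+1%:R / m%:R.
have lam0 : lam != 0 by rewrite mulf_neq0 ?invr_eq0 ?pnatr_eq0// -lt0n.
set A := scaled_rate R m N; set r := scaled_branch R m N.
have stayE : stay_weight R m N.+1 = (fun l => 1 - A l / lam).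
  by apply/funext => l; rewrite /A /scaled_rate -/lam mulrAC divff// mul1r; ring.
have branchE : branch_weight R m N.+1 = (fun l => r l / lam).
  by apply/funext => l; rewrite /r /scaled_branch -/lam mulrAC divff// mul1r.
have lower n0 : \sum_(n < M) (\sum_(l < n.+1) coef A r n l *
      (expR (- (lam * t)) * \sum_(k < n0) exp_coeff (lam * t) k * (1 - A l / lam) ^+ k)) *
    branch_sum Q mu C n Leaf <= fine (nu C).
  rewrite -lee_fin fineK; last by rewrite fin_num_measure.
  rewrite nuE//; apply: le_trans (agent_state_ge m_gt0 XS M n0 mN t_ge0 mC mA).
  rewrite lee_fin le_eqVlt; apply/orP; left; apply/eqP.
  under [in RHS]eq_bigr do rewrite mulr_sumr.
  rewrite exchange_big /=; apply: eq_bigr => n _.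
  under [in RHS]eq_bigr do rewrite mulrA.
  rewrite -mulr_suml; congr (_ * _).
  have chainE k : chain (stay_weight R m N.+1) (branch_weight R m N.+1) k 0 n =
      \sum_(l < n.+1) coef A r n l * (1 - A l / lam) ^+ k.
    rewrite stayE branchE chain_coef// => l k' lk kn.
    by apply: dist_rate => //; apply: leq_trans kn (ltnW _).
  under [RHS]eq_bigr do rewrite chainE mulr_sumr.
  rewrite exchange_big /=; apply: eq_bigr => l _.
  by rewrite !mulr_sumr; apply: eq_bigr => k _; ring.
set f := (X in forall n0, X n0 <= _) in lower.
suff cf : f n0 @[n0 --> \oo] -->
    \sum_(n < M) population_weight N n * branch_sum Q mu C n Leaf.
  by apply: ler_cvg_to cf (cvg_cst _) _; apply: nearW.
apply: cvg_big => [|n _]; first exact: add_continuous.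
apply: cvgM; last exact: cvg_cst.
apply: cvg_big => [|l _]; first exact: add_continuous.
apply: cvgM; first exact: cvg_cst.
have -> : - A l * t = - (lam * t * (1 - (1 - A l / lam))) by field.
exact: exp_coeff_sum_cvg.
Qed.

Let mass C n := branch_sum Q mu C n Leaf.

Lemma branch_sum_compl C n : measurable C ->
  mass C n + mass (~` C) n = (num_trees m n)%:R.
Proof.
move=> mC; rewrite /mass !branch_sum_trees -big_split /=.
rewrite (eq_bigr (fun=> 1)) => [|A _].
  by rewrite big_const_seq count_predT size_trees// iter_addr_0.
have mC' := measurableC mC.
by rewrite (probability_setC _ mC) fineB ?fin_num_measure//= addrC subrK.
Qed.

Variable p : nat -> R -> R.
Hypothesis p_birth : birth_weights m p.

Let trees_gt0 n : 0 < (num_trees m n)%:R :> R.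
Proof.
rewrite ltr0n; elim: n => [|n IH]; first by rewrite /num_trees big_geq.
by rewrite num_treesS muln_gt0 IH addn1.
Qed.

(** Uniqueness identifies [p] twice: here with the form in which the limit is taken, and in
    [p_closed] with the one that gives sign and mass. *)
Let p_limit_weight n : p n t = (num_trees m n)%:R * limit_weight n.
Proof.
exact: (birth_weights_unique p_birth (coef_weights_birth R m_ge2)).
Qed.

Let p_closed n : p n t = closed_weights m n t.
Proof.
exact: (birth_weights_unique p_birth (closed_weights_birth R m_ge2)).
Qed.

Let limit_weight_ge0 n : 0 <= limit_weight n.
Proof.
by rewrite -(pmulr_rge0 _ (trees_gt0 n)) -p_limit_weight p_closed closed_weights_ge0.
Qed.

Let term C n : R := limit_weight n * mass C n.

Let term_ge0 C n : 0 <= term C n.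
Proof. by rewrite mulr_ge0// branch_sum_ge0. Qed.

Let term_compl C n : measurable C -> term C n + term (~` C) n = p n t.
Proof. by move=> mC; rewrite -mulrDr branch_sum_compl// p_limit_weight mulrC. Qed.

Let limit_lawE C : measurable C ->
  limit_law Q mu p t C = (\sum_(n <oo) (term C n)%:E)%E.
Proof.
move=> mC.
apply: eq_eseriesr => n _; rewrite /term [in RHS]EFinM.
have -> : p n t / (num_trees m n)%:R = limit_weight n.
  by rewrite p_limit_weight mulrAC divff ?mul1r// gt_eqF.
congr (_ * _)%E; rewrite /mass branch_sum_trees -sumEFin.
by apply: eq_bigr => A _; rewrite fineK// fin_num_measure.
Qed.

Lemma limit_law_ge C M : measurable C ->
  ((\sum_(n < M) limit_weight n * branch_sum Q mu C n Leaf)%:E <= limit_law Q mu p t C)%E.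
Proof.
move=> mC; rewrite limit_lawE// -sumEFin -(big_mkord xpredT (fun n => (term C n)%:E)).
by apply: nneseries_lim_ge => n _ _; rewrite lee_fin term_ge0.
Qed.

Lemma limit_law_compl C : measurable C ->
  (limit_law Q mu p t C + limit_law Q mu p t (~` C) <= 1)%E.
Proof.
move=> mC; have mC' := measurableC mC.
rewrite !limit_lawE// -nneseriesD; last 2 first.
- by move=> n _ _; rewrite lee_fin term_ge0.
- by move=> n _ _; rewrite lee_fin term_ge0.
apply: lime_le.
  by apply: is_cvg_nneseries => n _ _; rewrite -EFinD lee_fin addr_ge0 ?term_ge0.
apply: nearW => M.
under eq_bigr do rewrite -EFinD term_compl// p_closed.
rewrite big_mkord sumEFin lee_fin.
case: M => [|M]; first by rewrite big_ord0.
by have /andP[] := sum_closed_weights m_ge2 M t_ge0.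
Qed.

Lemma sum_weights_cvg :
  \sum_(n < M.+1) (num_trees m n)%:R * limit_weight n @[M --> \oo] --> (1 : R).
Proof.
under eq_fun do under eq_bigr do rewrite -p_limit_weight p_closed.
exact: sum_closed_weights_cvg.
Qed.

Let branch_sum_le C n : measurable C -> mass C n <= (num_trees m n)%:R.
Proof. by move=> mC; rewrite -(branch_sum_compl n mC) lerDl branch_sum_ge0. Qed.

Lemma tv_dist_le N M nu e : (m <= N.+1)%N -> agent_law N.+1 Q mu t nu ->
  (forall l n, (l < n)%N -> (n <= M)%N ->
    scaled_rate R m N n - scaled_rate R m N l != 0) ->
  1 - e <= \sum_(n < M) (num_trees m n)%:R * limit_weight n ->
  \sum_(n < M) `|population_weight N n - limit_weight n| * (num_trees m n)%:R <= e ->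
  (0 <= tv_dist nu (limit_law Q mu p t) <= (2 * e)%:E)%E.
Proof.
move=> mN nu_law dist_rate sum_ge diff_le.
pose s C := \sum_(n < M) limit_weight n * mass C n.
have s_compl C : measurable C -> 1 - e <= s C + s (~` C).
  move=> mC; rewrite -big_split /=; apply: le_trans sum_ge _.
  by apply: ler_sum => n _; rewrite -mulrDr branch_sum_compl// mulrC.
have nu_ge C : measurable C -> s C - e <= fine (nu C).
  move=> mC; apply: le_trans (agent_law_ge mN dist_rate nu_law mC).
  rewrite lerBlDr -lerBlDl; apply: le_trans diff_le.
  rewrite -sumrB; apply: ler_sum => n _; rewrite -mulrBl.
  apply: le_trans (ler_norm _) _; rewrite normrM distrC ler_wpM2l//.
  by rewrite ger0_norm ?branch_sum_ge0// branch_sum_le.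
have dist_le C : measurable C -> (`|nu C - limit_law Q mu p t C| <= (2 * e)%:E)%E.
  move=> mC; have mC' := measurableC mC.
  have := limit_law_compl mC; have := limit_law_ge M mC; have := limit_law_ge M mC'.
  rewrite -/(s C) -/(s (~` C)).
  have := nu_ge _ mC; have := nu_ge _ mC'; have := s_compl _ mC.
  rewrite (probability_setC _ mC).
  have : nu C \is a fin_num by rewrite fin_num_measure.
  case: (nu C) => [x| |]// _.
  case: (limit_law _ _ _ _ C) => [y| |]//; case: (limit_law _ _ _ _ (~` C)) => [z| |]//=.
  rewrite !lee_fin => h1 h2 h3 h4 h5 h6; rewrite ler_norml.
  by apply/andP; split; lra.
apply/andP; split; last by apply: ge_ereal_sup => _ [C mC <-]; exact: dist_le.
apply: le_trans (ereal_sup_ubound _); last by exists setT.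
exact: abse_ge0.
Qed.

End convergence.

Theorem proposition3 (R : realType) (d : measure_display)
  (E : measurableType d) (m : nat) (m_ge2 : (2 <= m)%N)
  (Q : R.-pker (m.-tuple E) ~> (m.-tuple E)) (Q_sym : symmetric_kernel Q)
  (mu : probability E R)
  (p : nat -> R -> R) (p_birth : birth_weights m p)
  (t : R) (t_ge0 : 0 <= t)
  (mu_star : nat -> probability E R)
  (mu_star_law : forall N, (m <= N)%N -> agent_law N Q mu t (mu_star N)) :
  tv_dist (mu_star N) (limit_law Q mu p t) @[N --> \oo] --> 0%E.
Proof.
(* The weights indexed by [N] describe a population of [N.+1] agents. *)
rewrite -cvg_shiftS.
have close e : 0 < e -> \forall N \near \oo,
    (0 <= tv_dist (mu_star N.+1) (limit_law Q mu p t) <= (2 * e)%:E)%E.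
  move=> e0.
  (* [M] is fixed first, from the limiting mass alone; then [N] is taken large enough for the
     finitely many weights below [M]. *)
  have [M sum_ge] : exists M, 1 - e <= \sum_(n < M) (num_trees m n)%:R * limit_weight m t n.
    have /cvgrPdist_le/(_ _ e0)[M _ /(_ M (leqnn _))] :=
      sum_weights_cvg m_ge2 t_ge0 p_birth.
    by rewrite /= ler_distlC => /andP[h _]; exists M.+1.
  have /cvgrPdist_le/(_ _ e0) diff : \sum_(n < M)
      `|population_weight m t N n - limit_weight m t n| * (num_trees m n)%:R
      @[N --> \oo] --> (0 : R).
    rewrite [X in _ --> X](_ : _ = \sum_(n < M) `|0 : R| * (num_trees m n)%:R); last first.
      by rewrite big1// => n _; rewrite normr0 mul0r.
    apply: cvg_big => [|n _]; first exact: add_continuous.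
    apply: cvgM; last exact: cvg_cst.
    apply: cvg_norm; rewrite -[X in _ --> X](subrr (limit_weight m t n)).
    by apply: cvgB; [exact: population_weight_cvg|exact: cvg_cst].
  have dist_rate := scaled_rate_distinct R (ltnW m_ge2) m_ge2 M.
  near=> N.
  have mN : (m <= N.+1)%N by near: N; exists m => // n /= mn; exact: leqW.
  apply: (tv_dist_le m_ge2 t_ge0 p_birth mN (mu_star_law _ mN) (M := M)) => //.
    by near: N.
  have : `|0 - \sum_(n < M) `|population_weight m t N n - limit_weight m t n| *
    (num_trees m n)%:R| <= e by near: N; exact: diff.
  by rewrite sub0r normrN => /(le_trans (ler_norm _)).
apply/fine_cvgP; split.
  (* Any fixed bound makes the distance finite, so the convergence can be checked on real
     numbers. *)
  have := close 1 ltr01; apply: filterS => N /andP[h0 h1].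
  by rewrite ge0_fin_numE// (le_lt_trans h1)// ltry.
apply/cvgr0Pnorm_le => e e0.
have e20 : 0 < e / 2 by rewrite divr_gt0.
have := close _ e20; apply: filterS => N /=.
case: (tv_dist _ _) => [x| |]; rewrite ?lee_fin//= => /andP[x0 xe].
by rewrite ger0_norm//; lra.
Unshelve. all: by end_near. Qed.
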